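(* Suppose Assumptions A and B (stated in the context) hold. Then the following statements hold. (i) For any given $\xi\in\Xi$, $f_{21}(\cdot,\cdot,\xi)$ is continuously differentiable and strongly convex-concave (strongly convex in $x_2$, concave in $y_1$); moreover, $\nabla_{y_1}f_{21}$ and $\nabla_{x_2}f_{21}$ are Lipschitz continuous with respect to $(x_2,y_1)$ and continuous with respect to $\xi$. (ii) For any given $\xi\in\Xi$, $f_{22}(\cdot,\cdot,\xi)$ is continuously differentiable and convex-strongly concave (convex in $x_1$, strongly concave in $y_2$); moreover, $\nabla_{x_1}f_{22}$ and $\nabla_{y_2}f_{22}$ are Lipschitz continuous with respect to $(x_1,y_2)$ and continuous with respect to $\xi$. (iii) For any given $\xi\in\Xi$, $\psi_2(\cdot,\cdot,\xi)$ is convex-concave and continuously differentiable. There exist mappings $\bar{\mathbf x}_2:X_1\times Y_1\times\Xi\to\mathbb R^{n_2}$, $\bar{\mathbf y}_2:X_1\times Y_1\times\Xi\to\mathbb R^{m_2}$, $\boldsymbol\pi_{x_2}:X_1\times Y_1\times\Xi\to\mathbb R^{l_2}$ and $\boldsymbol\pi_{y_2}:X_1\times Y_1\times\Xi\to\mathbb R^{s_2}$ such that, for every $(x_1,y_1,\xi)\in X_1\times Y_1\times\Xi$, the quadruple $(\bar{\mathbf x}_2,\bar{\mathbf y}_2,\boldsymbol\pi_{x_2},\boldsymbol\pi_{y_2})(x_1,y_1,\xi)$ satisfies the KKT condition $H(\mu,\xi)=0$ of the second-stage minimax problem, where $$\nabla_{x_1}\psi_2(\cdot,\cdot,\xi)=T(\xi)^\top\boldsymbol\pi_{x_2}(\cdot,\cdot,\xi),\qquad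 \nabla_{y_1}\psi_2(\cdot,\cdot,\xi)=-A(\xi)^\top\boldsymbol\pi_{y_2}(\cdot,\cdot,\xi),$$ and $(\bar{\mathbf x}_2(x_1,y_1,\xi),\bar{\mathbf y}_2(x_1,y_1,\xi))$ is the unique saddle point of the second-stage minimax problem. Moreover, $(\bar{\mathbf x}_2,\bar{\mathbf y}_2,\boldsymbol\pi_{x_2},\boldsymbol\pi_{y_2})$ is Lipschitz continuous with respect to $(x_1,y_1)$ over $X_1\times Y_1$ and continuous with respect to $\xi$. (iv) There is a convex and compact set $\hat X_2\times\hat Y_2\subset\mathbb R^{n_2}\times\mathbb R^{m_2}$ containing $(\bar{\mathbf x}_2(x_1,y_1,\xi),\bar{\mathbf y}_2(x_1,y_1,\xi))$ for all $(x_1,y_1,\xi)\in X_1\times Y_1\times\Xi$. Moreover, there exist convex and compact sets $\check X_2\supset\hat X_2$ and $\check Y_2\supset\hat Y_2$ such that $$\max_{y_2\in Y_2(y_1,\xi)\cap\check Y_2}F_2(x_2,y_2,\xi)=f_{21}(x_2,y_1,\xi)\quad\forall (x_2,y_1,\xi)\in\hat X_2\times Y_1\times\Xi,$$ $$\min_{x_2\in X_2(x_1,\xi)\cap\check X_2}F_2(x_2,y_2,\xi)=f_{22}(x_1,y_2,\xi)\quad\forall (x_1,y_2,\xi)\in X_1\times\hat Y_2\times\Xi.$$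
   Context: Setting. $\xi:\Omega\to\Xi\subset\mathbb R^l$ is a random vector on a probability space $(\Omega,\mathcal F,P)$ with support $\Xi$. $X_1\subset\mathbb R^{n_1}$, $Y_1\subset\mathbb R^{m_1}$ are convex compact sets. $F_2:\mathbb R^{n_2}\times\mathbb R^{m_2}\times\mathbb R^l\to\mathbb R$ is such that for a.e. $\xi\in\Xi$, $F_2(\cdot,\cdot,\xi)$ is $\sigma$-strongly convex-strongly concave with $\sigma>0$ (i.e. $\sigma$-strongly convex in $x_2$ for each fixed $y_2$ and $\sigma$-strongly concave in $y_2$ for each fixed $x_2$). For $\xi\in\Xi$: $T(\xi)\in\mathbb R^{l_2\times n_1}$, $W(\xi)\in\mathbb R^{l_2\times n_2}$, $A(\xi)\in\mathbb R^{s_2\times m_1}$, $B(\xi)\in\mathbb R^{s_2\times m_2}$, $h(\xi)\in\mathbb R^{l_2}$, $c(\xi)\in\mathbb R^{s_2}$, and $$X_2(x_1,\xi)=\{x_2\in\mathbb R^{n_2}:T(\xi)x_1+W(\xi)x_2\le h(\xi)\},\quad Y_2(y_1,\xi)=\{y_2\in\mathbb R^{m_2}:A(\xi)y_1+B(\xi)y_2\le c(\xi)\}.$$ The second-stage minimax problem and its value are $$\psi_2(x_1,y_1,\xi)=\min_{x_2\in X_2(x_1,\xi)}\max_{y_2\in Y_2(y_1,\xi)}F_2(x_2,y_2,\xi).$$ A saddle point of it is $(x_2^*,y_2^* )\in X_2(x_1,\xi)\times Y_2(y_1,\xi)$ with $F_2(x_2^*,y_2,\xi)\le F_2(x_2^*,y_2^*,\xi)\le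 F_2(x_2,y_2^*,\xi)$ for all $x_2\in X_2(x_1,\xi)$, $y_2\in Y_2(y_1,\xi)$. Further $$f_{21}(x_2,y_1,\xi)=\max_{y_2\in Y_2(y_1,\xi)}F_2(x_2,y_2,\xi),\qquad f_{22}(x_1,y_2,\xi)=\min_{x_2\in X_2(x_1,\xi)}F_2(x_2,y_2,\xi).$$ KKT condition of the second-stage problem for given $(x_1,y_1)$, in the variable $\mu=(x_2,y_2,\pi_{x_2},\pi_{y_2})\in\mathbb R^{n_2}\times\mathbb R^{m_2}\times\mathbb R^{l_2}\times\mathbb R^{s_2}$ (min is componentwise): $$H(\mu,\xi)=\begin{pmatrix}\nabla_{x_2}F_2(x_2,y_2,\xi)+W(\xi)^\top\pi_{x_2}\\-\nabla_{y_2}F_2(x_2,y_2,\xi)+B(\xi)^\top\pi_{y_2}\\ \min(\pi_{x_2},h(\xi)-T(\xi)x_1-W(\xi)x_2)\\ \min(\pi_{y_2},c(\xi)-A(\xi)y_1-B(\xi)y_2)\end{pmatrix}=0.$$ Assumption A. For every $(x_1,y_1)\in X_1\times Y_1$ and $\xi\in\Xi$: (i) $F_2$ is continuous, $F_2(\cdot,\cdot,\xi)$ is continuously differentiable with Lipschitz gradient, and $\nabla_{x_2}F_2$ and $\nabla_{y_2}F_2$ are Lipschitz continuous; (ii) $X_2(x_1,\xi)$ and $Y_2(y_1,\xi)$ are nonempty; (iii) $B(\xi)$ and $W(\xi)$ have full row rank. Assumption B. The support $\Xi\subset\mathbb R^l$ of $\xi$ is compact, and $A(\cdot),B(\cdot),T(\cdot),W(\cdot),c(\cdot),h(\cdot)$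 are continuous. *)

(* Defs.v *)
From mathcomp Require Export all_boot all_order all_algebra.
From mathcomp Require Export all_classical all_reals all_analysis.

Set Implicit Arguments.
Unset Strict Implicit.
Unset Printing Implicit Defensive.

Export Order.TTheory GRing.Theory Num.Theory.
Export numFieldNormedType.Exports.

Local Open Scope classical_set_scope.
Local Open Scope ring_scope.
Local Open Scope convex_scope.

Section Calculus.
Variable R : realType.

(* R^n is 'cV[R]_n. The library norm on 'cV[R]_n is the sup norm, which is only
   used for topology and Lipschitz continuity; strong convexity refers to the
   Euclidean norm. *)
Definition sqnorm2 n (x : 'cV[R]_n) : R := \sum_i x i 0 ^+ 2.

Definition le_cv n (u v : 'cV[R]_n) : Prop := forall i, u i 0 <= v i 0.

Definition min_cv n (u v : 'cV[R]_n) : 'cV[R]_n :=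
  \col_i Num.min (u i 0) (v i 0).

Definition is_max (S : set R) (v : R) : Prop := S v /\ ubound S v.
Definition is_min (S : set R) (v : R) : Prop := S v /\ lbound S v.

Definition concave_function n (f : 'cV[R]_n -> R^o) : Prop :=
  convex_function setT (fun x => - f x : R^o).

Definition strongly_convex (s : R) n (f : 'cV[R]_n -> R^o) : Prop :=
  forall (t : {i01 R}) (x y : convex_lmodType 'cV[R]_n),
    f (x <| t |> y) <=
      (f x <| t |> f y) - s / 2 * (t%:num * (1 - t%:num)) * sqnorm2 (x - y).

Definition strongly_concave (s : R) n (f : 'cV[R]_n -> R^o) : Prop :=
  strongly_convex s (fun x => - f x : R^o).

Definition grad n (f : 'cV[R]_n -> R^o) (x : 'cV[R]_n) : 'cV[R]_n :=
  \col_i 'D_(delta_mx i 0) f x.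

Section TwoVariables.
Variables n m : nat.
Implicit Type f : 'cV[R]_n -> 'cV[R]_m -> R^o.

Definition gradl f (x : 'cV[R]_n) (y : 'cV[R]_m) : 'cV[R]_n := grad (f^~ y) x.
Definition gradr f (x : 'cV[R]_n) (y : 'cV[R]_m) : 'cV[R]_m := grad (f x) y.

Definition continuously_differentiable f : Prop :=
  [/\ forall p : 'cV[R]_n * 'cV[R]_m,
        differentiable (fun q : 'cV[R]_n * 'cV[R]_m => f q.1 q.2) p,
      continuous (fun p : 'cV[R]_n * 'cV[R]_m => gradl f p.1 p.2) &
      continuous (fun p : 'cV[R]_n * 'cV[R]_m => gradr f p.1 p.2)].

Definition lipschitz_gradient f : Prop :=
  [lipschitz gradl f p.1 p.2 | p in [set: 'cV[R]_n * 'cV[R]_m]] /\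
  [lipschitz gradr f p.1 p.2 | p in [set: 'cV[R]_n * 'cV[R]_m]].

Definition is_saddle_point (X : set 'cV[R]_n) (Y : set 'cV[R]_m) f
    (p : 'cV[R]_n * 'cV[R]_m) : Prop :=
  [/\ X p.1, Y p.2,
      forall y, Y y -> f p.1 y <= f p.1 p.2 &
      forall x, X x -> f p.1 p.2 <= f x p.2].

End TwoVariables.
End Calculus.

Section RandomVector.
Context {R : realType} {d : measure_display} {Omega : measurableType d}.
Variables (P : probability Omega R) (l : nat).
Implicit Type xi : Omega -> 'cV[R]_l.

Definition random_vector xi : Prop :=
  forall i, measurable_fun [set: Omega] (fun w => xi w i 0).

Definition support_of xi : set 'cV[R]_l :=
  [set z | forall U, open_nbhs z U -> (0%E < P (xi @^-1` U))%E].

End RandomVector.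

Record second_stage (R : realType) (n1 m1 n2 m2 l l2 s2 : nat) := SecondStage {
  F2 : 'cV[R]_n2 -> 'cV[R]_m2 -> 'cV[R]_l -> R^o;
  matT : 'cV[R]_l -> 'M[R]_(l2, n1);
  matW : 'cV[R]_l -> 'M[R]_(l2, n2);
  matA : 'cV[R]_l -> 'M[R]_(s2, m1);
  matB : 'cV[R]_l -> 'M[R]_(s2, m2);
  vech : 'cV[R]_l -> 'cV[R]_l2;
  vecc : 'cV[R]_l -> 'cV[R]_s2 }.

Section SecondStageProblem.
Context {R : realType} {n1 m1 n2 m2 l l2 s2 : nat}.
Variable D : second_stage R n1 m1 n2 m2 l l2 s2.

Definition F2at (z : 'cV[R]_l) : 'cV[R]_n2 -> 'cV[R]_m2 -> R^o := fun x2 y2 => F2 D x2 y2 z.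

Definition X2 (x1 : 'cV[R]_n1) (z : 'cV[R]_l) : set 'cV[R]_n2 :=
  [set x2 | le_cv (matT D z *m x1 + matW D z *m x2) (vech D z)].

Definition Y2 (y1 : 'cV[R]_m1) (z : 'cV[R]_l) : set 'cV[R]_m2 :=
  [set y2 | le_cv (matA D z *m y1 + matB D z *m y2) (vecc D z)].

(* The extrema below are taken with the total operators sup and inf; that they
   are attained has to be stated separately, with is_max and is_min. *)
Definition f21 (z : 'cV[R]_l) (x2 : 'cV[R]_n2) (y1 : 'cV[R]_m1) : R^o :=
  sup [set F2 D x2 y2 z | y2 in Y2 y1 z].

Definition f22 (z : 'cV[R]_l) (x1 : 'cV[R]_n1) (y2 : 'cV[R]_m2) : R^o :=
  inf [set F2 D x2 y2 z | x2 in X2 x1 z].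

Definition psi2 (z : 'cV[R]_l) (x1 : 'cV[R]_n1) (y1 : 'cV[R]_m1) : R^o :=
  inf [set f21 z x2 y1 | x2 in X2 x1 z].

Definition H (x1 : 'cV[R]_n1) (y1 : 'cV[R]_m1) (z : 'cV[R]_l)
    (x2 : 'cV[R]_n2) (y2 : 'cV[R]_m2) (px : 'cV[R]_l2) (py : 'cV[R]_s2) :
    'cV[R]_(n2 + (m2 + (l2 + s2))) :=
  col_mx (gradl (F2at z) x2 y2 + (matW D z)^T *m px)
 (col_mx (- gradr (F2at z) x2 y2 + (matB D z)^T *m py)
 (col_mx (min_cv px (vech D z - matT D z *m x1 - matW D z *m x2))
         (min_cv py (vecc D z - matA D z *m y1 - matB D z *m y2)))).

Variables (X1 : set 'cV[R]_n1) (Y1 : set 'cV[R]_m1) (Xi : set 'cV[R]_l).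

Record assumptionA : Prop := AssumptionA {
  F2_continuous : {within [set p | Xi p.2],
    continuous (fun p : 'cV[R]_n2 * 'cV[R]_m2 * 'cV[R]_l =>
                  F2 D p.1.1 p.1.2 p.2)};
  F2_C1 : forall z, Xi z -> continuously_differentiable (F2at z);
  F2_lipschitz_gradient : forall z, Xi z -> lipschitz_gradient (F2at z);
  feasible : forall x1 y1 z, X1 x1 -> Y1 y1 -> Xi z ->
    X2 x1 z !=set0 /\ Y2 y1 z !=set0;
  full_row_rank : forall z, Xi z -> row_free (matB D z) /\ row_free (matW D z)
}.

Record assumptionB : Prop := AssumptionB {
  Xi_compact : compact Xi;
  matA_continuous : {within Xi, continuous (matA D)};
  matB_continuous : {within Xi, continuous (matB D)};
  matT_continuous : {within Xi, continuous (matT D)};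
  matW_continuous : {within Xi, continuous (matW D)};
  vecc_continuous : {within Xi, continuous (vecc D)};
  vech_continuous : {within Xi, continuous (vech D)}
}.

End SecondStageProblem.

(* Main.v *)
(* The key step is partial minimisation of a function [g u v], strongly convex in
   [u], over the polyhedron [T x + W u <= h] with [W] of full row rank.  Moving the
   right-hand side can be compensated by the right inverse of [W], which keeps all
   slacks unchanged.  Testing optimality of a minimizer against such a shifted point
   bounds its distance to the shifted point by a gradient residual, which gives both
   Lipschitz continuity in [(x, v)] and continuity in the scenario.  The same shift
   gives a quadratic sandwich for the optimal value (Danskin), hence its C^1
   regularity with gradient [T^T pi] in [x].  This is applied to [F2] (giving [f22]),
   to [- F2] with the variables exchanged (giving [f21]) and to [f21] (giving [psi2]);
   the saddle point comes from the minimizer of [f21] because its optimality condition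
   only involves the gradient of [F2]. *)
Require Import Defs.
From HB Require Import structures.
From mathcomp Require Import all_boot all_order all_algebra.
From mathcomp Require Import all_classical all_reals all_analysis.
From mathcomp Require Import ring lra.

Local Open Scope classical_set_scope.
Local Open Scope ring_scope.
Import Order.TTheory GRing.Theory Num.Theory.

Set Implicit Arguments.
Unset Strict Implicit.
Unset Printing Implicit Defensive.

(** * Inner product, sup norm and closed balls *)

Section Vectors.
Variable R : realType.

(** Two obstacles shape the argument. The Lipschitz constants of the gradients of [F2] are given
    scenario by scenario, and only the values of [F2], not its gradients, are known to be continuous
    in the scenario. Continuity of the gradients is therefore extracted from convexity, and the
    convergence of minimizers relies on the modulus [sigma], which is common to all scenarios.
    Moreover strong convexity-concavity is given almost surely, while the conclusions concern every
    point of the support: good scenarios accumulate at each such point, and the defining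
    inequalities pass to the limit. The class [quad_approx] is stable under partial minimization;
    this lets [f21], for which only plain concavity in [y1] is kept, be minimized again by the same
    lemmas. Full row rank makes the multiplier an explicit linear image of the gradient, so it
    inherits Lipschitz continuity and limits without any selection argument. Limits are taken along
    arbitrary filters, so that the same lemmas give continuity in the scenario and the joint
    continuity needed for compactness. *)

Definition dot n (x y : 'cV[R]_n) : R := (x^T *m y) 0 0.

Lemma dotE n (x y : 'cV[R]_n) : dot x y = \sum_i x i 0 * y i 0.
Proof. by rewrite /dot mxE; apply: eq_bigr => i _; rewrite mxE. Qed.

Lemma dotC n (x y : 'cV[R]_n) : dot x y = dot y x.
Proof. by rewrite !dotE; apply: eq_bigr => i _; rewrite mulrC. Qed.

Lemma dotDr n (x y z : 'cV[R]_n) : dot x (y + z) = dot x y + dot x z.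
Proof. by rewrite /dot mulmxDr mxE. Qed.

Lemma dotNr n (x y : 'cV[R]_n) : dot x (- y) = - dot x y.
Proof. by rewrite /dot mulmxN mxE. Qed.

Lemma dotBr n (x y z : 'cV[R]_n) : dot x (y - z) = dot x y - dot x z.
Proof. by rewrite dotDr dotNr. Qed.

Lemma dotZr n c (x y : 'cV[R]_n) : dot x (c *: y) = c * dot x y.
Proof. by rewrite /dot -scalemxAr mxE. Qed.

Lemma dotDl n (x y z : 'cV[R]_n) : dot (x + y) z = dot x z + dot y z.
Proof. by rewrite !(dotC _ z) dotDr. Qed.

Lemma dotNl n (x y : 'cV[R]_n) : dot (- x) y = - dot x y.
Proof. by rewrite !(dotC _ y) dotNr. Qed.

Lemma dotBl n (x y z : 'cV[R]_n) : dot (x - y) z = dot x z - dot y z.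
Proof. by rewrite dotDl dotNl. Qed.

Lemma dotZl n c (x y : 'cV[R]_n) : dot (c *: x) y = c * dot x y.
Proof. by rewrite !(dotC _ y) dotZr. Qed.

Lemma dot0r n (x : 'cV[R]_n) : dot x 0 = 0.
Proof. by rewrite /dot mulmx0 mxE. Qed.

Lemma dot_mulmx n m (A : 'M[R]_(m, n)) (x : 'cV[R]_m) (y : 'cV[R]_n) :
  dot (A^T *m x) y = dot x (A *m y).
Proof. by rewrite /dot trmx_mul trmxK mulmxA. Qed.

Lemma dot_delta n (x : 'cV[R]_n) i : dot x (delta_mx i 0) = x i 0.
Proof.
rewrite dotE (bigD1 i) //= big1 => [|j ji]; last by rewrite mxE (negbTE ji) mulr0.
by rewrite mxE !eqxx mulr1 addr0.
Qed.

Lemma sqnorm2E n (x : 'cV[R]_n) : sqnorm2 x = dot x x.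
Proof. by rewrite dotE; apply: eq_bigr => i _; rewrite expr2. Qed.

Lemma sqnorm2_ge0 n (x : 'cV[R]_n) : 0 <= sqnorm2 x.
Proof. by apply: sumr_ge0 => i _; rewrite sqr_ge0. Qed.

Lemma coord_le_norm n m (x : 'M[R]_(n, m)) i j : `|x i j| <= `|x|.
Proof.
rewrite [leRHS]/Num.Def.normr /= mx_normrE.
by apply/bigmax_geP; right => /=; exists (i, j).
Qed.

Lemma mx_norm_le n m (x : 'M[R]_(n, m)) c :
  0 <= c -> (forall i j, `|x i j| <= c) -> `|x| <= c.
Proof.
move=> c0 xc; rewrite [leLHS]/Num.Def.normr /= mx_normrE.
by apply/bigmax_leP; split => // -[i j] _ /=.
Qed.

Lemma norm_delta n (i : 'I_n) : `|delta_mx i 0 : 'cV[R]_n| <= 1.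
Proof.
apply: mx_norm_le => // j k; rewrite mxE.
by case: (_ && _); rewrite ?normr0 ?normr1.
Qed.

Lemma norm_mulmx_le n m p (A : 'M[R]_(m, n)) (B : 'M[R]_(n, p)) :
  `|A *m B| <= n%:R * `|A| * `|B|.
Proof.
apply: mx_norm_le => [|i j]; first by rewrite !mulr_ge0.
rewrite mxE; apply: le_trans (ler_norm_sum _ _ _) _.
apply: (@le_trans _ _ (\sum_(k < n) `|A| * `|B|)).
  by apply: ler_sum => k _; rewrite normrM ler_pM // coord_le_norm.
by rewrite sumr_const card_ord -mulrA mulr_natl.
Qed.

Lemma norm_dot_le n (x y : 'cV[R]_n) : `|dot x y| <= n%:R * `|x| * `|y|.
Proof.
apply: le_trans (coord_le_norm _ 0 0) _.
apply: le_trans (norm_mulmx_le _ _) _.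
rewrite ler_wpM2r // ler_wpM2l //.
by apply: mx_norm_le => // i j; rewrite mxE coord_le_norm.
Qed.

(** The bridge between the two norms: strong convexity produces Euclidean squares, while all
    distance estimates are made in the sup norm. *)
Lemma norm_sqr_le n (x : 'cV[R]_n) : `|x| ^+ 2 <= sqnorm2 x.
Proof.
have s0 := sqnorm2_ge0 x.
rewrite -(sqr_sqrtr s0) ler_sqr ?nnegrE ?sqrtr_ge0 //.
apply: mx_norm_le => [|i j]; first exact: sqrtr_ge0.
rewrite ord1 -ler_sqr ?nnegrE ?sqrtr_ge0 // sqr_sqrtr //.
rewrite real_normK ?num_real // /sqnorm2 (bigD1 i) //= lerDl.
by apply: sumr_ge0 => k _; rewrite sqr_ge0.
Qed.

Lemma sqnorm2N n (x : 'cV[R]_n) : sqnorm2 (- x) = sqnorm2 x.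
Proof. by rewrite !sqnorm2E dotNl dotNr opprK. Qed.

Lemma closed_ball_compact n (M : R) : compact [set x : 'cV[R]_n | `|x| <= M].
Proof.
have tr_cont : continuous (trmx : 'rV[R]_n -> 'cV[R]_n).
  move=> x A /nbhs_ballP[e e0 eA]; apply/nbhs_ballP; exists e => // y [_ xy].
  by apply: eA; split => // i j; rewrite !mxE.
(* Transposition is an isometry for the sup norm, so compactness is carried over from row
   vectors. *)
have -> : [set x : 'cV[R]_n | `|x| <= M] = trmx @` [set x : 'rV[R]_n | `|x| <= M].
  apply/seteqP; split => [x /= xM|_ [y /= yM <-]].
    exists x^T; last by rewrite trmxK.
    rewrite /=; apply: le_trans xM.
    by apply: mx_norm_le => // i j; rewrite mxE coord_le_norm.
  by apply: le_trans yM; apply: mx_norm_le => // i j; rewrite mxE coord_le_norm.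
apply: continuous_compact; first exact: continuous_subspaceT.
apply: bounded_closed_compact.
  by exists M; split; rewrite ?num_real // => N MN x /= xM; apply: le_trans xM (ltW MN).
have -> : [set x : 'rV[R]_n | `|x| <= M] = Num.norm @^-1` [set x | x <= M] by [].
by apply: closed_comp => [x _|]; [exact: norm_continuous|exact: closed_le].
Qed.

Local Open Scope convex_scope.
Lemma closed_ball_convex n (M : R) : convex_set [set x : 'cV[R]_n | `|x| <= M].
Proof.
move=> x y t; rewrite !inE /= => xM yM.
have t0 : 0 <= t%:num :> R by []. have t1 : 0 <= 1 - t%:num :> R by rewrite subr_ge0.
apply: le_trans (ler_normD _ _) _; rewrite !normrZ.
rewrite !ger0_norm // /unstable.onem.
by have := ler_wpM2l t0 xM; have := ler_wpM2l t1 yM; lra.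
Qed.

End Vectors.

(** * Convergence of matrix-valued maps along a filter *)

Section Limits.
Variables (R : realType) (T : Type).
Context {F : set_system T} {FF : Filter F}.

Lemma cvg_mxP m n (f : T -> 'M[R]_(m, n)) (A : 'M[R]_(m, n)) :
  f @ F --> A <-> forall i j, (fun t => f t i j) @ F --> A i j.
Proof.
split=> [fA i j|fA].
  exact: (cvg_comp _ _ fA (@coord_continuous R m n i j A)).
apply/cvg_ballP => e e0.
have : \forall t \near F, forall i : 'I_m * 'I_n, ball (A i.1 i.2) e (f t i.1 i.2).
  by apply: filter_forall => -[i j]; move/cvg_ballP: (fA i j); apply.
by apply: filterS => t ft; split => // i j; exact: (ft (i, j)).
Qed.

Lemma cvg_mulmx m n p (f : T -> 'M[R]_(m, n)) (g : T -> 'M[R]_(n, p))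
    (A : 'M[R]_(m, n)) (B : 'M[R]_(n, p)) :
  f @ F --> A -> g @ F --> B -> (fun t => f t *m g t) @ F --> A *m B.
Proof.
move=> /cvg_mxP fA /cvg_mxP gB; apply/cvg_mxP => i j.
rewrite mxE; under eq_cvg do rewrite mxE.
by apply: cvg_big => [|k _]; [exact: add_continuous|exact: cvgM].
Qed.

Lemma cvg_trmx m n (f : T -> 'M[R]_(m, n)) (A : 'M[R]_(m, n)) :
  f @ F --> A -> (fun t => (f t)^T) @ F --> A^T.
Proof.
move=> /cvg_mxP fA; apply/cvg_mxP => i j.
by rewrite mxE; under eq_cvg do rewrite mxE; exact: fA.
Qed.

Lemma cvg_det n (f : T -> 'M[R]_n) (A : 'M[R]_n) :
  f @ F --> A -> (fun t => \det (f t)) @ F --> \det A.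
Proof.
move=> /cvg_mxP fA; apply: cvg_big => [|s _]; first exact: add_continuous.
apply: cvgM; first exact: cvg_cst.
by apply: cvg_big => [|i _]; [exact: mul_continuous|exact: fA].
Qed.

Lemma cvg_adj n (f : T -> 'M[R]_n) (A : 'M[R]_n) :
  f @ F --> A -> (fun t => \adj (f t)) @ F --> \adj A.
Proof.
move=> fA; apply/cvg_mxP => i j.
rewrite mxE /cofactor; under eq_cvg do rewrite mxE /cofactor.
apply: cvgM; first exact: cvg_cst.
apply: cvg_det; apply/cvg_mxP => k l; rewrite !mxE; under eq_cvg do rewrite !mxE.
by move/cvg_mxP: fA; apply.
Qed.

End Limits.

(** * Right inverse of a matrix of full row rank *)

Section RightInverse.
Variables (R : realType) (m n : nat).
Implicit Type W : 'M[R]_(m, n).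

(* The Moore-Penrose right inverse; the determinant formula makes it manifestly
   continuous in [W]. *)
Definition rinv W : 'M[R]_(n, m) :=
  W^T *m ((\det (W *m W^T))^-1 *: \adj (W *m W^T)).

(** If [K] is the left kernel of the Gram matrix, then [K *m W] times its own transpose vanishes;
    the diagonal entries are sums of squares, so [K *m W = 0], and full row rank gives [K = 0]. *)
Lemma gram_det_neq0 W : row_free W -> \det (W *m W^T) != 0.
Proof.
move=> Wfree; rewrite -unitfE -unitmxE -row_free_unit -kermx_eq0.
set K := kermx _; rewrite -(mulmx_free_eq0 K Wfree).
have KW0 : (K *m W) *m (K *m W)^T = 0.
  by rewrite trmx_mul mulmxA -(mulmxA K) mulmx_ker mul0mx.
apply/eqP/matrixP => i j; rewrite [RHS]mxE.
have /eqP := congr1 (fun M : 'M[R]_m => M i i) KW0.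
rewrite [X in X == _]mxE [X in _ == X]mxE psumr_eq0 => [/allP/(_ j)|k _].
  by rewrite mem_index_enum [_^T _ _]mxE -expr2 sqrf_eq0 => /(_ isT)/eqP.
by rewrite [_^T _ _]mxE -expr2 sqr_ge0.
Qed.

Lemma mul_rinv W : row_free W -> W *m rinv W = 1%:M.
Proof.
move=> Wfree; rewrite /rinv mulmxA -scalemxAr mul_mx_adj.
by rewrite scale_scalar_mx mulVf // gram_det_neq0.
Qed.

Lemma cvg_rinv T (F : set_system T) {FF : Filter F} (f : T -> 'M[R]_(m, n)) W :
  row_free W -> f @ F --> W -> (fun t => rinv (f t)) @ F --> rinv W.
Proof.
move=> Wfree fW.
have gW : (fun t => f t *m (f t)^T) @ F --> W *m W^T.
  by apply: cvg_mulmx => //; exact: cvg_trmx.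
apply: cvg_mulmx; first exact: cvg_trmx.
apply: cvgZ; last exact: cvg_adj.
by apply: cvgV; [exact: gram_det_neq0|exact: cvg_det].
Qed.

End RightInverse.

Lemma lipschitzP (R : realType) (V W : normedModType R) (f : V -> W) (A : set V) :
  lipschitz_on f (globally (A `*` A)) <->
  exists2 L, 0 <= L & forall p q, A p -> A q -> `|f p - f q| <= L * `|p - q|.
Proof.
(* [lipschitz_on] asks for the estimate with all large enough constants: [M + 1] is one of them, and
   the maximum with [0] makes it nonnegative. *)
split=> [[M [_ fM]]|[L L0 fL]].
  exists (Num.max 0 (M + 1)) => [|p q Ap Aq]; first by rewrite le_max lexx.
  by apply: (fM _ _ (p, q)) => //; rewrite lt_max ltrDl ltr01 orbT.
exists L; split; rewrite ?num_real // => M LM [p q] [/= Ap Aq].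
by apply: le_trans (fL _ _ Ap Aq) _; rewrite ler_wpM2r // ltW.
Qed.

(** * Functions with a first-order expansion and quadratic remainder *)

Section QuadraticApproximation.
Variable R : realType.
Variables n m : nat.
Implicit Type f : 'cV[R]_n -> 'cV[R]_m -> R^o.
Implicit Type a : 'cV[R]_n -> 'cV[R]_m -> 'cV[R]_n.
Implicit Type b : 'cV[R]_n -> 'cV[R]_m -> 'cV[R]_m.

(** The sum of the distances, equivalent to the product norm up to a factor 2, makes constants of
    compositions add and is symmetric under exchange of the variables. *)
Definition lip2 k (f : 'cV[R]_n -> 'cV[R]_m -> 'cV[R]_k) : Prop :=
  exists2 L, 0 <= L & forall x y x' y',
    `|f x' y' - f x y| <= L * (`|x' - x| + `|y' - y|).

(* Equivalent to: [f] is C^1 with Lipschitz gradient [(a, b)]. *)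
Definition quad_approx f a b : Prop :=
  exists2 L, 0 <= L & forall x y x' y',
    `|f x' y' - f x y - dot (a x y) (x' - x) - dot (b x y) (y' - y)|
      <= L * (`|x' - x| + `|y' - y|) ^+ 2.

Lemma lip2_lipschitz k (f : 'cV[R]_n -> 'cV[R]_m -> 'cV[R]_k) :
  lip2 f -> [lipschitz f p.1 p.2 | p in [set: 'cV[R]_n * 'cV[R]_m]].
Proof.
move=> [L L0 fL]; apply/lipschitzP; exists (L * 2) => [|p q _ _].
  by rewrite mulr_ge0.
apply: le_trans (fL _ _ _ _) _; rewrite -mulrA ler_wpM2l //.
by rewrite mulr_natl mulr2n lerD // [leRHS]prod_normE le_max lexx ?orbT.
Qed.

Lemma lipschitz_lip2 k (f : 'cV[R]_n -> 'cV[R]_m -> 'cV[R]_k) :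
  [lipschitz f p.1 p.2 | p in [set: 'cV[R]_n * 'cV[R]_m]] -> lip2 f.
Proof.
move=> /lipschitzP [L L0 fL]; exists L => // x y x' y'.
apply: le_trans (fL (x', y') (x, y) _ _) _ => //; rewrite ler_wpM2l //.
by rewrite prod_normE ge_max /= lerDl lerDr !normr_ge0.
Qed.

Lemma lip2_continuous k (f : 'cV[R]_n -> 'cV[R]_m -> 'cV[R]_k) :
  lip2 f -> continuous (fun p : 'cV[R]_n * 'cV[R]_m => f p.1 p.2).
Proof.
move=> [L L0 fL] [x y]; apply/(@cvgrPdist_le _ _ _ (nbhs (x, y))) => e e0.
have d0 : 0 < e / (2 * (L + 1)) by rewrite divr_gt0 // mulr_gt0 // ltr_wpDl.
apply/nbhs_ballP; exists (e / (2 * (L + 1))) => //= -[x' y'] [/=].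
rewrite -!ball_normE /ball_ /= => xx' yy'.
apply: le_trans (fL _ _ _ _) _.
apply: (@le_trans _ _ (L * (e / (L + 1)))).
  rewrite ler_wpM2l //.
  have -> : e / (L + 1) = e / (2 * (L + 1)) + e / (2 * (L + 1)).
    by field; rewrite gt_eqF // ltr_wpDl.
  by rewrite lerD // ltW.
by rewrite mulrCA ger_pMr // ler_pdivrMr ?mul1r ?lerDl // ltr_wpDl.
Qed.

Lemma quad_approxN f a b : quad_approx f a b ->
  quad_approx (fun x y => - f x y) (fun x y => - a x y) (fun x y => - b x y).
Proof.
move=> [L L0 fL]; exists L => // x y x' y'.
have := fL x y x' y'; rewrite !dotNl !ler_norml => /andP[h1 h2].
by apply/andP; split; lra.
Qed.

(** The value at the third point [(x' + s *: e, y')] is expanded from [(x, y)] and from [(x', y')].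
    Subtracting these expansions and the one of [f x' y'] at [(x, y)] leaves [s] times the [i]-th
    coordinate of [a x' y' - a x y]. The remainders are [4 * L * s ^+ 2], [L * s ^+ 2] and
    [L * s ^+ 2], whence the constant 6 after division by [s]; [s = 0] is treated apart. *)
Lemma quad_approx_lipl f a b : quad_approx f a b -> lip2 a.
Proof.
move=> [L L0 fL]; exists (6 * L) => [|x y x' y']; first by rewrite mulr_ge0.
set s := `|x' - x| + `|y' - y|.
have s0 : 0 <= s by rewrite addr_ge0.
have [s00|sn0] := eqVneq s 0.
  have /andP[] : (`|x' - x| == 0) && (`|y' - y| == 0) by rewrite -paddr_eq0 ?normr_ge0 // -/s s00.
  rewrite !normr_eq0 !subr_eq0 => /eqP -> /eqP ->.
  by rewrite subrr normr0 mulr_ge0 // mulr_ge0.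
have sp : 0 < s by rewrite lt_def sn0.
apply: mx_norm_le => [|i j]; first by rewrite !mulr_ge0.
rewrite ord1 {j} -(ler_pM2l sp) -[X in X * `|_|]ger0_norm // -normrM.
set e := delta_mx i 0 : 'cV[R]_n.
have se : `|s *: e| <= s by rewrite normrZ ger0_norm // ler_piMr // norm_delta.
have E1 := fL x y (x' + s *: e) y'.
have E2 := fL x' y' (x' + s *: e) y'.
have E3 := fL x y x' y'.
have le1 : `|x' + s *: e - x| + `|y' - y| <= 2 * s.
  have -> : x' + s *: e - x = (x' - x) + s *: e by rewrite addrAC.
  by have := ler_normD (x' - x) (s *: e); rewrite /s in se *; lra.
have le2 : `|x' + s *: e - x'| + `|y' - y'| <= s.
  by rewrite subrr normr0 addr0 addrAC subrr add0r.
have sq1 : (`|x' + s *: e - x| + `|y' - y|) ^+ 2 <= (2 * s) ^+ 2.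
  by rewrite lerXn2r ?nnegrE ?addr_ge0 ?mulr_ge0.
have sq2 : (`|x' + s *: e - x'| + `|y' - y'|) ^+ 2 <= s ^+ 2.
  by rewrite lerXn2r ?nnegrE ?addr_ge0 ?mulr_ge0.
have {sq1} := ler_wpM2l L0 sq1; have {sq2} := ler_wpM2l L0 sq2.
move: E1 E2 E3; rewrite -/s !dotBr !dotDr !dotZr !dot_delta !subrr.
rewrite !mxE !expr2 !ler_norml => /andP[? ?] /andP[? ?] /andP[? ?] ? ?.
by apply/andP; split; lra.
Qed.

End QuadraticApproximation.

Lemma quad_approx_swap (R : realType) n m f a b :
  @quad_approx R n m f a b -> quad_approx (fun y x => f x y) (fun y x => b x y) (fun y x => a x y).
Proof.
move=> [L L0 fL]; exists L => // x y x' y'.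
by rewrite addrAC [`|x' - x| + _]addrC; exact: fL.
Qed.

Lemma quad_approx_lipr (R : realType) n m f a b :
  @quad_approx R n m f a b -> lip2 b.
Proof.
move=> /quad_approx_swap/quad_approx_lipl [L L0 fL]; exists L => // x y x' y'.
by rewrite [`|x' - x| + _]addrC; exact: fL.
Qed.

(** * Quadratic remainders versus C^1 functions with Lipschitz gradient *)

Section Differentials.
Variable R : realType.
Variables n m : nat.
Let E : normedModType R := ('cV[R]_n * 'cV[R]_m)%type.
Implicit Type f : 'cV[R]_n -> 'cV[R]_m -> R^o.

Definition dot_pair (a : 'cV[R]_n) (b : 'cV[R]_m) (p : E) : R^o :=
  dot a p.1 + dot b p.2.

Lemma dot_pair_linear a b : linear (dot_pair a b).
Proof.
move=> k [x y] [x' y']; rewrite /dot_pair /= !dotDr !dotZr.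
by rewrite scalerDr addrACA.
Qed.

HB.instance Definition _ a b :=
  GRing.isLinear.Build R E R^o *:%R (dot_pair a b) (dot_pair_linear a b).

Lemma norm_dot_pair_le a b (p : E) :
  `|dot_pair a b p| <= (n%:R * `|a| + m%:R * `|b|) * `|p|.
Proof.
apply: le_trans (ler_normD _ _) _; rewrite mulrDl.
have p1 : `|p.1| <= `|p| by rewrite [leRHS]prod_normE le_max lexx.
have p2 : `|p.2| <= `|p| by rewrite [leRHS]prod_normE le_max lexx orbT.
by apply: lerD; apply: le_trans (norm_dot_le _ _) _; rewrite ler_wpM2l // mulr_ge0.
Qed.

Lemma dot_pair_continuous a b : continuous (dot_pair a b).
Proof.
apply: bounded_linear_continuous; apply/linear_boundedP.
exists (n%:R * `|a| + m%:R * `|b|); split; first by rewrite num_real.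
move=> r /ltW rM p; apply: le_trans (norm_dot_pair_le _ _ _) _.
by rewrite ler_wpM2r.
Qed.

Lemma quad_approx_diff f a b (p : E) : quad_approx f a b ->
  differentiable (fun q : E => f q.1 q.2) p /\
  'd (fun q : E => f q.1 q.2) p = dot_pair (a p.1 p.2) (b p.1 p.2) :> (E -> R^o).
Proof.
move=> [L L0 fL]; set F := fun q : E => f q.1 q.2.
have eqF : F \o shift p = cst (F p) + dot_pair (a p.1 p.2) (b p.1 p.2) +o_ (0 : E) id.
  apply/eqaddoP => e e0; apply/nbhs_ballP.
  have L1 : 0 < 4 * (L + 1) by rewrite mulr_gt0 // ltr_wpDl.
  (* The sum of the two norms is at most twice the product norm of [q], so the remainder is at most
     [4 * L] times the square of that norm. *)
  exists (e / (4 * (L + 1))) => /=; first by rewrite divr_gt0.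
  move=> q; rewrite -ball_normE /ball_ /= sub0r normrN => qe.
  have q1 : `|q.1| <= `|q| by rewrite [leRHS]prod_normE le_max lexx.
  have q2 : `|q.2| <= `|q| by rewrite [leRHS]prod_normE le_max lexx orbT.
  have := fL p.1 p.2 (p.1 + q.1) (p.2 + q.2).
  rewrite ![_ + q.1]addrC ![_ + q.2]addrC !addrK => h.
  have -> : (F \o shift p - (cst (F p) + dot_pair (a p.1 p.2) (b p.1 p.2))) q =
     f (q.1 + p.1) (q.2 + p.2) - f p.1 p.2 - dot (a p.1 p.2) q.1 - dot (b p.1 p.2) q.2.
    by rewrite !fctE /F /dot_pair /= !opprD !addrA.
  apply: le_trans h _.
  apply: (@le_trans _ _ (L * (2 * `|q|) ^+ 2)).
    by rewrite ler_wpM2l // lerXn2r ?nnegrE ?addr_ge0 ?mulr_ge0 //; lra.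
  have -> : L * (2 * `|q|) ^+ 2 = `|q| * (4 * L) * `|q| by ring.
  apply: ler_wpM2r => //; move: qe; rewrite ltr_pdivlMr // => qe.
  by have := normr_ge0 q; lra.
have dfE := diff_unique (@dot_pair_continuous _ _) eqF.
split=> //; apply/diff_locallyP; rewrite dfE; split=> //.
exact: dot_pair_continuous.
Qed.

Lemma derive_partial_l f (x : 'cV[R]_n) (y : 'cV[R]_m) v :
  'D_v (f^~ y) x = 'D_((v, 0) : E) (fun q : E => f q.1 q.2) (x, y).
Proof.
rewrite /derive.
suff -> : (fun h : R => h^-1 *: (((f^~ y) \o shift x) (h *: v) - f x y)) =
  (fun h : R => h^-1 *: (((fun q : E => f q.1 q.2) \o shift ((x, y) : E))
    (h *: ((v, 0) : E)) - f x y)) by [].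
by apply/funext => h /=; rewrite scaler0 add0r.
Qed.

Lemma derive_partial_r f (x : 'cV[R]_n) (y : 'cV[R]_m) v :
  'D_v (f x) y = 'D_((0, v) : E) (fun q : E => f q.1 q.2) (x, y).
Proof.
rewrite /derive.
suff -> : (fun h : R => h^-1 *: ((f x \o shift y) (h *: v) - f x y)) =
  (fun h : R => h^-1 *: (((fun q : E => f q.1 q.2) \o shift ((x, y) : E))
    (h *: ((0, v) : E)) - f x y)) by [].
by apply/funext => h /=; rewrite scaler0 add0r.
Qed.

Lemma quad_approx_gradl f a b x y : quad_approx f a b -> gradl f x y = a x y.
Proof.
move=> /(@quad_approx_diff _ _ _ (x, y)) [df dfE].
apply/matrixP => i j; rewrite ord1 mxE derive_partial_l deriveE // dfE.
by rewrite /dot_pair /= dot0r addr0 dot_delta.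
Qed.

Lemma quad_approx_gradr f a b x y : quad_approx f a b -> gradr f x y = b x y.
Proof.
move=> /(@quad_approx_diff _ _ _ (x, y)) [df dfE].
apply/matrixP => i j; rewrite ord1 mxE derive_partial_r deriveE // dfE.
by rewrite /dot_pair /= dot0r add0r dot_delta.
Qed.

Lemma quad_approx_C1 f a b : quad_approx f a b ->
  continuously_differentiable f /\ lipschitz_gradient f.
Proof.
move=> fab.
have Ea : gradl f = a.
  by apply/funext => x; apply/funext => y; exact: quad_approx_gradl fab.
have Eb : gradr f = b.
  by apply/funext => x; apply/funext => y; exact: quad_approx_gradr fab.
have la := quad_approx_lipl fab; have lb := quad_approx_lipr fab.
rewrite /continuously_differentiable /lipschitz_gradient Ea Eb.
split; split; [| exact: lip2_continuous | exact: lip2_continuous |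
  exact: lip2_lipschitz | exact: lip2_lipschitz].
by move=> p; have [] := quad_approx_diff p fab.
Qed.

Lemma col_sum_delta k (x : 'cV[R]_k) : x = \sum_i x i 0 *: delta_mx i 0.
Proof.
by rewrite {1}[x]matrix_sum_delta; apply: eq_bigr => i _; rewrite big_ord1.
Qed.

(** [gradl] and [gradr] only record derivatives along basis vectors; linearity of the differential
    recovers every direction. *)
Lemma diff_grad f (x dx : 'cV[R]_n) (y dy : 'cV[R]_m) :
  differentiable (fun q : E => f q.1 q.2) (x, y) ->
  'd (fun q : E => f q.1 q.2) (x, y) (dx, dy) =
    dot (gradl f x y) dx + dot (gradr f x y) dy.
Proof.
move=> df; set D := 'd _ _.
have -> : (dx, dy) = (dx, 0) + (0, dy) :> E by congr pair; rewrite /= ?addr0 ?add0r.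
rewrite linearD; congr (_ + _).
  have -> : (dx, 0) = \sum_i dx i 0 *: (delta_mx i 0, 0) :> E.
    rewrite [in LHS](col_sum_delta dx) (big_morph (fun u => (u, 0) : E) (id1 := 0)
      (op1 := +%R)) // => [|u v]; last by congr pair; rewrite /= addr0.
    by apply: eq_bigr => i _; congr pair; rewrite /= scaler0.
  rewrite linear_sum dotE; apply: eq_bigr => i _.
  by rewrite linearZ mxE derive_partial_l deriveE // mulrC.
have -> : (0, dy) = \sum_i dy i 0 *: (0, delta_mx i 0) :> E.
  rewrite [in LHS](col_sum_delta dy) (big_morph (fun u => (0, u) : E) (id1 := 0)
    (op1 := +%R)) // => [|u v]; last by congr pair; rewrite /= addr0.
  by apply: eq_bigr => i _; congr pair; rewrite /= scaler0.
rewrite linear_sum dotE; apply: eq_bigr => i _.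
by rewrite linearZ mxE derive_partial_r deriveE // mulrC.
Qed.

(** By the mean value theorem on the segment, the increment is the gradient at an intermediate point
    applied to the displacement; replacing it by the gradient at the base point costs the Lipschitz
    constants, weighted by the dimensions because [dot] is bounded in the sup norm. *)
Lemma C1_quad_approx f : continuously_differentiable f -> lipschitz_gradient f ->
  quad_approx f (gradl f) (gradr f).
Proof.
move=> [df _ _] [/lipschitz_lip2 [La La0 aL] /lipschitz_lip2 [Lb Lb0 bL]].
exists (n%:R * La + m%:R * Lb) => [|x y x' y'].
  by rewrite addr_ge0 // mulr_ge0.
set F := fun q : E => f q.1 q.2.
set dx := x' - x; set dy := y' - y.
pose g (t : R) : R^o := f (x + t *: dx) (y + t *: dy).
pose dg (t : R) : R := dot (gradl f (x + t *: dx) (y + t *: dy)) dx +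
            dot (gradr f (x + t *: dx) (y + t *: dy)) dy.
have gE (t : R) : is_derive t 1 g (dg t).
  (* The difference quotients of [g] are those of [F] at the moving point in the direction
     [(dx, dy)], so the derivative of [g] is a value of the differential of [F]. *)
  have quotE : (fun h : R => h^-1 *: ((g \o shift t) (h *: 1) - g t)) =
     (fun h => h^-1 *: ((F \o shift (x + t *: dx, y + t *: dy)) (h *: (dx, dy)) -
        F (x + t *: dx, y + t *: dy))).
    apply/funext => h; rewrite /F /g /=; congr (_ *: (f _ _ - _)).
      by rewrite [h%:A]mulr1 scalerDl addrCA.
    by rewrite [h%:A]mulr1 scalerDl addrCA.
  split; first by rewrite /derivable quotE; exact: diff_derivable.
  rewrite /derive quotE -/(derive _ _ _) deriveE // /dg -diff_grad //.
have [|c] := @MVT R g dg 0 1 ltr01 (fun t _ => gE t).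
  apply: derivable_within_continuous => t _; exact: ex_derive.
rewrite in_itv /= => /andP[c0 c1].
rewrite subr0 mulr1 /g !scale0r !addr0 !scale1r.
rewrite /dx /dy [x + (x' - x)]addrC [y + (y' - y)]addrC !subrK -/dx -/dy => ->.
set s := `|dx| + `|dy|.
have s0 : 0 <= s by rewrite addr_ge0.
have cs : `|x + c *: dx - x| + `|y + c *: dy - y| <= s.
  rewrite ![_ + c *: _]addrC !addrK !normrZ (ger0_norm (ltW c0)).
  by apply: lerD; rewrite ler_piMl ?(ltW c1).
have -> : dg c - dot (gradl f x y) dx - dot (gradr f x y) dy =
  dot (gradl f (x + c *: dx) (y + c *: dy) - gradl f x y) dx +
  dot (gradr f (x + c *: dx) (y + c *: dy) - gradr f x y) dy.
  by rewrite /dg !dotBl; ring.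
apply: le_trans (ler_normD _ _) _.
rewrite mulrDl; apply: lerD; apply: le_trans (norm_dot_le _ _) _.
  rewrite expr2 -!mulrA ler_wpM2l // mulrA; apply: ler_pM => //; last by rewrite lerDl.
  by apply: le_trans (aL _ _ _ _) _; rewrite ler_wpM2l.
rewrite expr2 -!mulrA ler_wpM2l // mulrA; apply: ler_pM => //; last by rewrite lerDr.
by apply: le_trans (bL _ _ _ _) _; rewrite ler_wpM2l.
Qed.

End Differentials.

(** * Strong convexity, first-order conditions and existence of minimizers *)

Section StrongConvexity.
Variable R : realType.
Variable n : nat.
Implicit Type f : 'cV[R]_n -> R^o.
Implicit Type X : set 'cV[R]_n.

Lemma strongly_convexP s f : strongly_convex s f <->
  forall (t : R) x y, 0 <= t -> t <= 1 -> f (t *: x + (1 - t) *: y) <=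
    t * f x + (1 - t) * f y - s / 2 * (t * (1 - t)) * sqnorm2 (x - y).
Proof.
split=> [fs t x y t0 t1|fs t x y]; first exact: (fs (Itv01 t0 t1) x y).
exact: fs.
Qed.

(** Convexity becomes the case of modulus 0, so that convex and strongly convex functions share the
    same lemmas. *)
Lemma convex_functionP f : convex_function setT f <-> strongly_convex 0 f.
Proof.
split=> fc t x y; have := fc t x y; last by rewrite !mul0r subr0.
by rewrite !mul0r subr0; apply; rewrite inE.
Qed.

Lemma concave_functionP f : concave_function f <-> strongly_concave 0 f.
Proof. exact: convex_functionP. Qed.

(* First-order form of [s]-strong convexity, [a] playing the role of the gradient. *)
Definition strong_grad s f (a : 'cV[R]_n -> 'cV[R]_n) : Prop :=
  forall x y, f x + dot (a x) (y - x) + s / 2 * sqnorm2 (y - x) <= f y.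

Definition quad_approx1 f (a : 'cV[R]_n -> 'cV[R]_n) : Prop :=
  exists2 L, 0 <= L & forall x y, `|f y - f x - dot (a x) (y - x)| <= L * `|y - x| ^+ 2.

(** Stands for letting [t] tend to 0 after dividing a first-order inequality by [t]. *)
Lemma le0_scaled (u K : R) : (forall t, 0 < t -> t <= 1 -> u <= t * K) -> u <= 0.
Proof.
move=> uK; apply/ler_addgt0Pl => e e0; rewrite addr0.
have K1 : 0 < `|K| + 1 by rewrite ltr_wpDl.
have t0 : 0 < Num.min 1 (e / (`|K| + 1)) by rewrite lt_min ltr01 divr_gt0.
apply: le_trans (uK _ t0 _) _; first by rewrite ge_min lexx.
have : Num.min 1 (e / (`|K| + 1)) * (`|K| + 1) <= e.
  by rewrite -ler_pdivlMr // ge_min lexx orbT.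
have := ler_norm K; nra.
Qed.

Lemma strongly_convex_grad s f a : strongly_convex s f -> quad_approx1 f a ->
  strong_grad s f a.
Proof.
move=> /strongly_convexP fs [L L0 fL] x y.
rewrite -subr_le0; set d := y - x.
(* The two terms of order [t] left after division: the expansion error, and the part of
   [s / 2 * (t * (1 - t))] that is quadratic in [t]. *)
apply: (@le0_scaled _ (L * `|d| ^+ 2 + s / 2 * sqnorm2 d)) => t t0 t1.
have := fs t y x (ltW t0) t1.
have -> : t *: y + (1 - t) *: x = x + t *: d.
  by rewrite scalerBl scale1r scalerBr addrCA.
have := fL x (x + t *: d); rewrite [x + _]addrC addrK dotZr normrZ gtr0_norm //.
rewrite -/d ler_norml => /andP[h1 _] h2.
rewrite -(ler_pM2l t0); move: h1 h2; rewrite !expr2; lra.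
Qed.

Lemma strong_grad_mono s f a x y : strong_grad s f a ->
  s * sqnorm2 (y - x) <= dot (a y) (y - x) - dot (a x) (y - x).
Proof.
move=> fa; have := fa x y; have := fa y x.
rewrite -[x - y]opprB sqnorm2N dotNr; lra.
Qed.

Lemma strong_gradW s f a : 0 <= s -> strong_grad s f a -> strong_grad 0 f a.
Proof.
move=> s0 fa x y; apply: le_trans (fa x y).
by rewrite !mul0r addr0 lerDl mulr_ge0 ?divr_ge0 ?sqnorm2_ge0.
Qed.

Lemma quad_approx1_continuous f a : quad_approx1 f a -> continuous f.
Proof.
move=> [L L0 fL] x; apply/(@cvgrPdist_le _ _ _ (nbhs x)) => e e0.
have C0 : 0 < n%:R * `|a x| + L + 1 by rewrite ltr_wpDl // addr_ge0 // mulr_ge0.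
set C := n%:R * `|a x| + L in C0.
apply/nbhs_ballP; exists (Num.min 1 (e / (C + 1))) => /=.
  by rewrite lt_min ltr01 divr_gt0.
move=> y; rewrite -ball_normE /ball_ /= distrC lt_min => /andP[y1 ye].
have {ye} : `|y - x| * (C + 1) <= e by rewrite -ler_pdivlMr // ltW.
have := norm_dot_le (a x) (y - x); rewrite ler_norml => /andP[h1 h2].
have /ler_normlP[h3 h4] := fL x y; rewrite expr2 in h3 h4.
rewrite /C ler_norml => h5.
have h6 : L * (`|y - x| * `|y - x|) <= L * `|y - x|.
  by rewrite ler_wpM2l // ler_piMl // ltW.
by have h7 := normr_ge0 (y - x); apply/andP; split; lra.
Qed.

Definition is_minimizer (X : set 'cV[R]_n) f u := X u /\ forall y, X y -> f u <= f y.

Definition segment_closed (X : set 'cV[R]_n) :=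
  forall x y t, X x -> X y -> 0 <= t -> t <= 1 -> X (x + t *: (y - x)).

Lemma minimizer_VI X f a u y : segment_closed X -> quad_approx1 f a ->
  is_minimizer X f u -> X y -> 0 <= dot (a u) (y - u).
Proof.
move=> Xs [L L0 fL] [Xu umin] Xy.
rewrite -oppr_le0; apply: (@le0_scaled _ (L * `|y - u| ^+ 2)) => t t0 t1.
have := umin _ (Xs _ _ _ Xu Xy (ltW t0) t1).
have := fL u (u + t *: (y - u)).
rewrite [u + _]addrC addrK dotZr normrZ gtr0_norm // ler_norml => /andP[_ h1] h2.
rewrite -(ler_pM2l t0); move: h1 h2; rewrite !expr2; lra.
Qed.

Lemma minimizer_unique X f a s u v : 0 < s -> segment_closed X -> quad_approx1 f a ->
  strong_grad s f a -> is_minimizer X f u -> is_minimizer X f v -> u = v.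
Proof.
move=> s0 Xs fq fa um vm.
have h1 := minimizer_VI Xs fq um vm.1.
have h2 := fa u v; have h3 := vm.2 _ um.1.
have h4 : `|v - u| ^+ 2 <= 0.
  apply: le_trans (norm_sqr_le _) _; rewrite -(ler_pM2l s0) mulr0; lra.
by apply/esym/eqP; rewrite -subr_eq0 -normr_eq0 -sqrf_eq0 eq_le h4 sqr_ge0.
Qed.

Lemma exists_minimizer X f a s : 0 < s -> X !=set0 -> closed X -> quad_approx1 f a ->
  strong_grad s f a -> exists u, is_minimizer X f u.
Proof.
move=> s0 [u0 Xu0] Xc fq fa.
(* Beyond distance [r] from [u0] the quadratic growth [s / 2 * sqnorm2 d] outweighs the linear term,
   which is at least [- (n%:R * |a u0| * |d|)]; the minimization is thus confined to a compact
   set. *)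
pose r := 2 * n%:R * `|a u0| / s.
have r0 : 0 <= r by rewrite divr_ge0 ?mulr_ge0 // ltW.
pose K := X `&` [set u | `|u| <= `|u0| + r].
have K0 : K !=set0 by exists u0; split => //=; rewrite lerDl.
have Kc : compact K by rewrite /K setIC; apply: compact_closedI => //; exact: closed_ball_compact.
have fc : {within K, continuous f}.
  by apply: continuous_subspaceT; exact: quad_approx1_continuous fq.
have [u] := compact_EVT_min K0 Kc fc.
rewrite inE => -[Xu uK] umin; exists u; split=> // y Xy.
have [yK|yK] := leP `|y| (`|u0| + r); first by apply: umin; rewrite inE.
have u0min : f u <= f u0 by apply: umin; rewrite inE; split => //=; rewrite lerDl.
apply: le_trans u0min _; apply: le_trans (fa u0 y).
rewrite -addrA lerDl; set d := y - u0.
have dr : r <= `|d| by have := ler_normB y u0; have := lerB_dist y u0; rewrite /d; lra.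
have := norm_dot_le (a u0) d; rewrite ler_norml => /andP[h1 _].
have h2 := norm_sqr_le d.
have h3 : 2 * n%:R * `|a u0| <= s * `|d|.
  by rewrite [leRHS]mulrC -ler_pdivrMr.
have := ler_wpM2r (normr_ge0 d) h3.
have := ler_wpM2l (ltW s0) h2; rewrite expr2; lra.
Qed.

End StrongConvexity.

(** * Polyhedra, KKT pairs and stability of constrained minimizers *)

Section Polyhedra.
Variables (R : realType) (n r : nat).
Implicit Types (W : 'M[R]_(r, n)) (b : 'cV[R]_r).

Definition poly W b : set 'cV[R]_n := [set u | le_cv (W *m u) b].

Lemma polyP W b u : poly W b u <-> forall i, 0 <= (b - W *m u) i 0.
Proof. by split=> h i; have := h i; rewrite !mxE subr_ge0. Qed.

Lemma poly_closed W b : closed (poly W b).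
Proof.
have -> : poly W b = \bigcap_(i in setT) [set u | (W *m u) i 0 <= b i 0].
  by apply/seteqP; split => u h i; [move=> _|]; exact: h.
apply: closed_bigI => i _.
have -> : [set u : 'cV[R]_n | (W *m u) i 0 <= b i 0] =
   (fun u : 'cV[R]_n => (W *m u) i 0) @^-1` [set x | x <= b i 0] by [].
apply: closed_comp => [u _|]; last exact: closed_le.
have FF := nbhs_filter (u : 'cV[R]_n).
have : W *m v @[v --> nbhs (u : 'cV[R]_n)] --> W *m u.
  by apply: cvg_mulmx; [exact: cvg_cst|exact: cvg_id].
by move/cvg_mxP; apply.
Qed.

Lemma poly_segment_closed W b : segment_closed (poly W b).
Proof.
move=> x y t xX yX t0 t1 i; have := xX i; have := yX i.
rewrite mulmxDr -scalemxAr mulmxBr !mxE; nra.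
Qed.

(** Through the right inverse every right-hand side is attained with equality, so partial minima are
    defined on the whole space and differentiability needs no boundary analysis. *)
Lemma poly_nonempty W b : row_free W -> poly W b !=set0.
Proof.
by move=> Wf; exists (rinv W *m b) => i; rewrite mulmxA mul_rinv // mul1mx.
Qed.

Lemma min_cv_eq0 (p q : 'cV[R]_r) : min_cv p q = 0 ->
  [/\ forall i, 0 <= p i 0, forall i, 0 <= q i 0 & dot p q = 0].
Proof.
move=> pq0.
have pq i : Num.min (p i 0) (q i 0) = 0.
  by have := congr1 (fun M : 'cV[R]_r => M i 0) pq0; rewrite !mxE.
have pi i : 0 <= p i 0 by rewrite -(pq i) ge_min lexx.
have qi i : 0 <= q i 0 by rewrite -(pq i) ge_min lexx orbT.
split=> //; rewrite dotE big1 // => i _.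
by have := pq i; case: leP => _ ->; rewrite ?mul0r ?mulr0.
Qed.

Lemma dot_ge0 (p q : 'cV[R]_r) : (forall i, 0 <= p i 0) -> (forall i, 0 <= q i 0) ->
  0 <= dot p q.
Proof. by move=> p0 q0; rewrite dotE sumr_ge0 // => i _; rewrite mulr_ge0. Qed.

(* A KKT pair is obtained by testing the variational inequality in the
   directions [v - rinv W *m W *m v] of the kernel of [W] and in the directions
   [rinv W *m delta_mx i 0], which move a single constraint. *)
Lemma VI_kkt W b u (g : 'cV[R]_n) : row_free W -> poly W b u ->
  (forall y, poly W b y -> 0 <= dot g (y - u)) ->
  g + W^T *m - ((rinv W)^T *m g) = 0 /\
  min_cv (- ((rinv W)^T *m g)) (b - W *m u) = 0.
Proof.
move=> Wf Xu VI; set p := - _; set s := b - _.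
have dotker v : W *m v = 0 -> dot g v = 0.
  move=> Wv; apply/eqP; rewrite eq_le -oppr_ge0 -dotNr; apply/andP; split.
    rewrite -[- v](addrK u); apply: VI => i.
    by rewrite mulmxDr mulmxN Wv oppr0 add0r.
  by rewrite -[v](addrK u); apply: VI => i; rewrite mulmxDr Wv add0r.
have WR : W *m rinv W = 1%:M by exact: mul_rinv.
have pE i : p i 0 = - dot g (rinv W *m delta_mx i 0).
  by rewrite -dot_mulmx dot_delta mxE.
split.
  apply/matrixP => i j; rewrite ord1 {j} [RHS]mxE -[LHS]dot_delta dotDl.
  rewrite dot_mulmx dotNl dot_mulmx mulmxA -dotBr; apply: dotker.
  by rewrite mulmxBr -(mulmxA (rinv W)) (mulmxA W (rinv W)) WR mul1mx subrr.
(* With [c = -1], always allowed, this gives the sign of the multiplier; with [c = s i 0], which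
   makes the constraint active, it gives complementarity. *)
have move_i i c : c <= s i 0 -> 0 <= c * - p i 0.
  move=> cs; rewrite pE opprK -dotZr.
  rewrite -[_ *: _](addrK u); apply: VI => k.
  rewrite mulmxDr -scalemxAr mulmxA WR mul1mx.
  move: cs (Xu k); rewrite /s !mxE; have [->|ki] := eqVneq k i.
    by rewrite mulr1; lra.
  by rewrite mulr0 add0r.
have s0 i : 0 <= s i 0 by move/polyP: Xu; exact.
have p0 i : 0 <= p i 0.
  have := move_i i (-1); rewrite mulN1r opprK; apply.
  exact: le_trans (s0 i).
apply/matrixP => i j; rewrite ord1 {j} mxE [RHS]mxE.
have sp : s i 0 * p i 0 <= 0 by have := move_i i (s i 0) (lexx _); lra.
apply/eqP; rewrite eq_le le_min p0 s0 !andbT ge_min.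
have [//|p_gt0] := leP (p i 0) 0; have [//|s_gt0] := leP (s i 0) 0.
by have := mulr_gt0 s_gt0 p_gt0; rewrite ltNge sp.
Qed.

(* Testing optimality of [u] against a point with the same slacks as a KKT point
   [u0] of another problem. *)
Lemma minimizer_stability W W0 b b0 f a s u u0 p0 w :
  0 < s -> quad_approx1 f a -> strong_grad s f a ->
  is_minimizer (poly W b) f u -> min_cv p0 (b0 - W0 *m u0) = 0 ->
  b - W *m w = b0 - W0 *m u0 ->
  s * `|w - u| <= n%:R * `|a w + W^T *m p0|.
Proof.
move=> s0 fq fa um /min_cv_eq0[p00 q00 pq0] slack.
have Xw : poly W b w by apply/polyP => i; rewrite slack.
have VI := minimizer_VI (@poly_segment_closed W b) fq um Xw.
have mono := strong_grad_mono u w fa.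
(* [w] has the slacks of [u0], hence is complementary to [p0], while the slacks of [u] are
   nonnegative. The multiplier term can thus be added to the monotonicity estimate, turning [a w]
   into the residual [a w + W^T *m p0]. *)
have pos : 0 <= dot p0 (W *m (w - u)).
  have -> : W *m (w - u) = (b - W *m u) - (b - W *m w).
    by rewrite mulmxBr opprB [RHS]addrC addrA subrK.
  rewrite dotBr slack pq0 subr0; apply: dot_ge0 => //.
  by move/polyP: um.1.
have h1 : s * `|w - u| ^+ 2 <= n%:R * `|a w + W^T *m p0| * `|w - u|.
  apply: le_trans (norm_dot_le _ _); apply: le_trans (ler_norm _).
  rewrite dotDl dot_mulmx.
  have := ler_wpM2l (ltW s0) (norm_sqr_le (w - u)); lra.
have [w0|w0] := eqVneq `|w - u| 0; first by rewrite w0 mulr0 mulr_ge0.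
have wp : 0 < `|w - u| by rewrite lt_def w0 normr_ge0.
by rewrite -(ler_pM2r wp) -mulrA -expr2.
Qed.

End Polyhedra.

Section Lip2.
Variable R : realType.

Lemma lip2_snd n m : lip2 (fun (x : 'cV[R]_n) (y : 'cV[R]_m) => y).
Proof. by exists 1 => // x y x' y'; rewrite mul1r lerDr. Qed.

Lemma lip2_comp n m p q k (F : 'cV[R]_n -> 'cV[R]_m -> 'cV[R]_k)
    (U : 'cV[R]_p -> 'cV[R]_q -> 'cV[R]_n) (V : 'cV[R]_p -> 'cV[R]_q -> 'cV[R]_m) :
  lip2 F -> lip2 U -> lip2 V -> lip2 (fun x y => F (U x y) (V x y)).
Proof.
move=> [L L0 FL] [LU LU0 UL] [LV LV0 VL].
exists (L * (LU + LV)) => [|x y x' y']; first by rewrite mulr_ge0 // addr_ge0.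
apply: le_trans (FL _ _ _ _) _; rewrite -mulrA ler_wpM2l // mulrDl.
exact: lerD (UL _ _ _ _) (VL _ _ _ _).
Qed.

Lemma lip2_mulmx n m k j (M : 'M[R]_(j, k)) (F : 'cV[R]_n -> 'cV[R]_m -> 'cV[R]_k) :
  lip2 F -> lip2 (fun x y => M *m F x y).
Proof.
move=> [L L0 FL]; exists (k%:R * `|M| * L) => [|x y x' y']; first by rewrite !mulr_ge0.
rewrite -mulmxBr; apply: le_trans (norm_mulmx_le _ _) _.
by rewrite -[leRHS]mulrA; apply: ler_wpM2l; [rewrite mulr_ge0|exact: FL].
Qed.

Lemma lip2N n m k (F : 'cV[R]_n -> 'cV[R]_m -> 'cV[R]_k) :
  lip2 F -> lip2 (fun x y => - F x y).
Proof. by move=> [L L0 FL]; exists L => // x y x' y'; rewrite -opprD normrN. Qed.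

End Lip2.

(** The default [0] is returned only when no minimizer exists, a case excluded by
    [parg_minimizer]. *)
Definition argmin (R : realType) n (X : set 'cV[R]_n) (f : 'cV[R]_n -> R^o) : 'cV[R]_n :=
  xget 0 [set u | is_minimizer X f u].

(** * Partial minimization over a parametrized polyhedron *)

Section PartialMinimization.
Variables (R : realType) (n m k r : nat).
Variables (g : 'cV[R]_n -> 'cV[R]_m -> R^o).
Variables (T : 'M[R]_(r, k)) (W : 'M[R]_(r, n)) (h : 'cV[R]_r).

Definition fiber (x : 'cV[R]_k) : set 'cV[R]_n := poly W (h - T *m x).

Definition parg (x : 'cV[R]_k) (v : 'cV[R]_m) : 'cV[R]_n := argmin (fiber x) (g^~ v).

Definition pmin (x : 'cV[R]_k) (v : 'cV[R]_m) : R^o := g (parg x v) v.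

Variables (a : 'cV[R]_n -> 'cV[R]_m -> 'cV[R]_n) (b : 'cV[R]_n -> 'cV[R]_m -> 'cV[R]_m).

(** The only possible multiplier: applying [(rinv W)^T] to the stationarity equation
    [a + W^T *m p = 0] cancels [W^T], since [W *m rinv W = 1%:M]. *)
Definition pmult (x : 'cV[R]_k) (v : 'cV[R]_m) : 'cV[R]_r :=
  - ((rinv W)^T *m a (parg x v) v).

Variable s : R.
Hypotheses (s_gt0 : 0 < s) (Wfree : row_free W).
Hypothesis gq : quad_approx g a b.
Hypothesis gs : forall v, strongly_convex s (g^~ v).

Lemma quad_approx_slice v : quad_approx1 (g^~ v) (a^~ v).
Proof.
have [L L0 gL] := gq; exists L => // x y.
by have := gL x v y v; rewrite subrr dot0r subr0 normr0 addr0.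
Qed.

Lemma strong_grad_slice v : strong_grad s (g^~ v) (a^~ v).
Proof. exact: strongly_convex_grad (gs v) (quad_approx_slice v). Qed.

Lemma parg_minimizer x v : is_minimizer (fiber x) (g^~ v) (parg x v).
Proof.
apply: (@xgetPex _ 0 [set u | is_minimizer (fiber x) (g^~ v) u]).
apply: (exists_minimizer s_gt0 (poly_nonempty _ Wfree) (@poly_closed _ _ _ _ _)).
  exact: quad_approx_slice.
exact: strong_grad_slice.
Qed.

Lemma parg_unique x v u : is_minimizer (fiber x) (g^~ v) u -> u = parg x v.
Proof.
move=> um; exact: (minimizer_unique s_gt0 (@poly_segment_closed _ _ _ _ _)
  (quad_approx_slice v) (strong_grad_slice v) um (parg_minimizer x v)).
Qed.

Lemma parg_kkt x v : a (parg x v) v + W^T *m pmult x v = 0 /\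
  min_cv (pmult x v) (h - T *m x - W *m parg x v) = 0.
Proof.
have um := parg_minimizer x v.
apply: (VI_kkt Wfree um.1) => y Xy.
exact: (minimizer_VI (@poly_segment_closed _ _ _ _ _) (quad_approx_slice v) um Xy).
Qed.

Lemma is_min_pmin x v : is_min [set g u v | u in fiber x] (pmin x v).
Proof.
have [Xu umin] := parg_minimizer x v.
by split; [exists (parg x v)|move=> _ [u Xu' <-]; exact: umin].
Qed.

Let shift_arg x v x' := parg x v - (rinv W *m T) *m (x' - x).

Lemma shift_slack x v x' :
  h - T *m x' - W *m shift_arg x v x' = h - T *m x - W *m parg x v.
Proof.
rewrite /shift_arg mulmxBr -(mulmxA (rinv W)) (mulmxA W (rinv W)) mul_rinv // mul1mx mulmxBr.
by rewrite !opprB !addrA; apply/matrixP => i j; rewrite !mxE; ring.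
Qed.

Lemma shift_feasible x v x' : fiber x' (shift_arg x v x').
Proof.
by apply/polyP => i; rewrite shift_slack; move/polyP: (parg_minimizer x v).1.
Qed.

Lemma lip2_parg : lip2 parg.
Proof.
have [L L0 aL] := quad_approx_lipl gq.
set C := k%:R * `|rinv W *m T|.
have C0 : 0 <= C by rewrite mulr_ge0.
(* [C] bounds the move from [u] to the shifted point [w]. By the KKT equation at [(x, v)] the
   residual at [w] is the gradient difference [a w v' - a u v], at most [L * (C + 1) * S]; stability
   multiplies it by [n%:R / s]. *)
exists (n%:R * L * (C + 1) / s + C) => [|x v x' v'].
  by rewrite addr_ge0 // divr_ge0 ?mulr_ge0 ?addr_ge0 // ltW.
set S := `|x' - x| + `|v' - v|; set u := parg x v; set w := shift_arg x v x'.
have [a0 p0] := parg_kkt x v.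
have := minimizer_stability s_gt0 (quad_approx_slice v') (strong_grad_slice v')
  (parg_minimizer x' v') p0 (shift_slack x v x').
have -> : W^T *m pmult x v = - a u v by apply/eqP; rewrite -addr_eq0 addrC a0.
have wu : `|w - u| <= C * `|x' - x|.
  by rewrite /w /shift_arg addrAC subrr add0r normrN; exact: norm_mulmx_le.
have : `|a w v' - a u v| <= L * ((C + 1) * S).
  apply: le_trans (aL _ _ _ _) _; rewrite ler_wpM2l // /S.
  have := normr_ge0 (x' - x); have := mulr_ge0 C0 (normr_ge0 (v' - v)); lra.
rewrite -/w => h1 h2.
have h3 : s * `|w - parg x' v'| <= n%:R * (L * ((C + 1) * S)).
  by apply: le_trans h2 _; rewrite ler_wpM2l.
have h4 : `|w - parg x' v'| <= n%:R * L * (C + 1) / s * S.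
  by rewrite -(ler_pM2l s_gt0); apply: le_trans h3 _; rewrite le_eqVlt; apply/orP; left;
    apply/eqP; field; rewrite gt_eqF.
have -> : parg x' v' - u = (w - u) - (w - parg x' v') by rewrite opprB [RHS]addrC addrA subrK.
apply: le_trans (ler_normB _ _) _; rewrite mulrDl addrC; apply: lerD h4 _.
by apply: le_trans wu _; rewrite ler_wpM2l // lerDl.
Qed.

Lemma lip2_pmult : lip2 pmult.
Proof.
apply: lip2N; apply: lip2_mulmx.
exact: lip2_comp (quad_approx_lipl gq) lip2_parg (lip2_snd _ _ _).
Qed.

(* Danskin's sandwich: shifting the minimizer at [(x, v)] gives a feasible point
   at [(x', v')], hence an upper bound; exchanging the roles gives the lower one. *)
Lemma pmin_upper : exists2 K, 0 <= K & forall x v x' v',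
  pmin x' v' - pmin x v <= dot (T^T *m pmult x v) (x' - x) +
    dot (b (parg x v) v) (v' - v) + K * (`|x' - x| + `|v' - v|) ^+ 2.
Proof.
have [L L0 gL] := gq.
set C := k%:R * `|rinv W *m T|.
have C0 : 0 <= C by rewrite mulr_ge0.
exists (L * (C + 1) ^+ 2) => [|x v x' v']; first by rewrite mulr_ge0 ?sqr_ge0.
set u := parg x v; set w := shift_arg x v x'.
have wmin : pmin x' v' <= g w v'.
  by apply: (parg_minimizer x' v').2; exact: shift_feasible.
have wu : w - u = - ((rinv W *m T) *m (x' - x)).
  by rewrite /w /shift_arg addrAC subrr add0r.
have := gL u v w v'; rewrite wu normrN dotNr.
have -> : dot (a u v) ((rinv W *m T) *m (x' - x)) = - dot (T^T *m pmult x v) (x' - x).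
  by rewrite -mulmxA dot_mulmx /pmult dotNl dot_mulmx opprK.
move=> /ler_normlP[_ h1].
have h2 : (`|(rinv W *m T) *m (x' - x)| + `|v' - v|) ^+ 2 <=
   ((C + 1) * (`|x' - x| + `|v' - v|)) ^+ 2.
  rewrite lerXn2r ?nnegrE ?mulr_ge0 ?addr_ge0 //.
  have := norm_mulmx_le (rinv W *m T) (x' - x); rewrite -/C.
  by have := normr_ge0 (x' - x); have := mulr_ge0 C0 (normr_ge0 (v' - v)); lra.
have := ler_wpM2l L0 h2; rewrite exprMn mulrA.
move: wmin h1; rewrite /pmin -/u; lra.
Qed.

(** The upper bound with the two points exchanged is a lower bound whose gradients sit at
    [(x', v')]; Lipschitz continuity of these gradients brings them back to [(x, v)] at quadratic
    cost, hence the terms in [La] and [Lb]. *)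
Lemma quad_approx_pmin :
  quad_approx pmin (fun x v => T^T *m pmult x v) (fun x v => b (parg x v) v).
Proof.
have [K K0 ub] := pmin_upper.
have [La La0 aL] := lip2_mulmx T^T lip2_pmult.
have [Lb Lb0 bL] := lip2_comp (quad_approx_lipr gq) lip2_parg (lip2_snd _ _ _).
exists (K + k%:R * La + m%:R * Lb) => [|x v x' v'].
  by rewrite !addr_ge0 ?mulr_ge0.
set S := `|x' - x| + `|v' - v|.
have h1 := ub x v x' v'; have h2 := ub x' v' x v.
rewrite ![`|x - _|]distrC ![`|v - _|]distrC -/S in h1 h2.
rewrite -[x - x']opprB -[v - v']opprB !dotNr in h2.
have S0 : 0 <= S by rewrite addr_ge0.
have xS : `|x' - x| <= S by rewrite lerDl.
have vS : `|v' - v| <= S by rewrite lerDr.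
have h3 : `|dot (T^T *m pmult x' v' - T^T *m pmult x v) (x' - x)| <= k%:R * La * S ^+ 2.
  apply: le_trans (norm_dot_le _ _) _; rewrite expr2 -!mulrA ler_wpM2l // mulrA.
  by apply: ler_pM.
have h4 : `|dot (b (parg x' v') v' - b (parg x v) v) (v' - v)| <= m%:R * Lb * S ^+ 2.
  apply: le_trans (norm_dot_le _ _) _; rewrite expr2 -!mulrA ler_wpM2l // mulrA.
  by apply: ler_pM.
rewrite !dotBl in h3 h4.
move: h3 h4 => /ler_normlP[h3 h3'] /ler_normlP[h4 h4'].
have kL : 0 <= k%:R * La * S ^+ 2 by rewrite !mulr_ge0 ?sqr_ge0.
have mL : 0 <= m%:R * Lb * S ^+ 2 by rewrite !mulr_ge0 ?sqr_ge0.
apply/ler_normlP; split; lra.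
Qed.

(** The constraint is affine jointly in [x] and [u], so the combination of two minimizers is
    feasible for the combined parameter. The modulus is lost because different [x] may share a
    minimizer. *)
Lemma pmin_convex v : strongly_convex 0 (pmin^~ v).
Proof.
apply/strongly_convexP => t x x' t0 t1; rewrite !mul0r subr0.
set u := parg x v; set u' := parg x' v.
have Xu := (parg_minimizer x v).1; have Xu' := (parg_minimizer x' v).1.
have Xt : fiber (t *: x + (1 - t) *: x') (t *: u + (1 - t) *: u').
  move=> i; have := Xu i; have := Xu' i.
  rewrite !mulmxDr -!scalemxAr !mxE; nra.
apply: le_trans ((parg_minimizer _ v).2 _ Xt) _.
have /strongly_convexP/(_ t u u' t0 t1) := gs v.
have := mulr_ge0 (mulr_ge0 t0 (_ : 0 <= 1 - t)) (sqnorm2_ge0 (u - u')).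
rewrite subr_ge0 => /(_ t1) h1 h2; apply: le_trans h2 _.
by rewrite gerDl oppr_le0 -mulrA mulr_ge0 // divr_ge0 // ltW.
Qed.

(** The fiber does not depend on [v]: the minimizer at the combined point competes at both end
    points, so the modulus in [v] survives intact. *)
Lemma pmin_concave c x : (forall u, strongly_concave c (g u)) ->
  strongly_concave c (pmin x).
Proof.
move=> gc; apply/strongly_convexP => t v v' t0 t1.
set u := parg x (t *: v + (1 - t) *: v').
have Xu : fiber x u := (parg_minimizer _ _).1.
have h1 : pmin x v <= g u v by exact: (parg_minimizer x v).2.
have h2 : pmin x v' <= g u v' by exact: (parg_minimizer x v').2.
have /strongly_convexP/(_ t v v' t0 t1) := gc u; rewrite -/u.
have := ler_wpM2l t0 h1.
have := @ler_wpM2l _ (1 - t) _ _ _ h2; rewrite subr_ge0 => /(_ t1).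
rewrite [pmin x (_ + _)]/pmin -/u; lra.
Qed.

End PartialMinimization.

(** * Convergence along filters: gradients, minimizers and multipliers *)

Lemma within_cvg (U V : topologicalType) (A : set U) (f : U -> V) (T : Type)
    (F : set_system T) {FF : Filter F} (u : T -> U) (u0 : U) :
  {within A, continuous f} -> A u0 -> (\forall t \near F, A (u t)) ->
  u @ F --> u0 -> f (u t) @[t --> F] --> f u0.
Proof.
move=> /subspace_continuousP/(_ _)fA Au0 Au uu0; apply: cvg_trans (fA _ Au0).
move=> P /= /uu0 uP; apply: filterS2 Au uP => t At; exact.
Qed.

(** Turns the filter statements into continuity on a set, be it the set of scenarios or a product of
    parameters and scenarios. *)
Lemma cvg_within_continuous (U V : topologicalType) (A : set U) (f : U -> V) :
  (forall u0 (F : set_system U), Filter F -> A u0 -> (\forall u \near F, A u) ->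
    F --> u0 -> f @ F --> f u0) -> {within A, continuous f}.
Proof.
move=> fA; apply/subspace_continuousP => x Ax; apply: fA => //.
- exact: withinT.
- exact: cvg_within.
Qed.

Lemma cvg_pair_proj (U V : topologicalType) (F : set_system (U * V)) (u : U) (v : V) :
  F --> (u, v) -> p.1 @[p --> F] --> u /\ p.2 @[p --> F] --> v.
Proof.
move=> Fuv; split.
- apply: cvg_trans (cvg_app fst Fuv) _; exact: cvg_fst.
- apply: cvg_trans (cvg_app snd Fuv) _; exact: cvg_snd.
Qed.

Lemma cvg_triple_proj (U V W : topologicalType) (F : set_system (U * V * W))
    (u : U) (v : V) (w : W) :
  F --> (u, v, w) ->
  [/\ p.1.1 @[p --> F] --> u, p.1.2 @[p --> F] --> v & p.2 @[p --> F] --> w].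
Proof. by move=> /cvg_pair_proj[/cvg_pair_proj[uF vF] wF]. Qed.

Section Stability.
Variables (R : realType) (T : Type).
Context {F : set_system T} {FF : Filter F}.

(* For convex functions, pointwise convergence to a differentiable function
   forces convergence of the gradients: the difference quotients bracket them. *)
Lemma grad_cvg n (f : T -> 'cV[R]_n -> R^o) (a : T -> 'cV[R]_n -> 'cV[R]_n)
    (x : T -> 'cV[R]_n) f0 a0 x0 :
  (\forall t \near F, strong_grad 0 (f t) (a t)) -> quad_approx1 f0 a0 ->
  (forall d, f t (x t + d) @[t --> F] --> f0 (x0 + d)) ->
  a t (x t) @[t --> F] --> a0 x0.
Proof.
move=> fa [L L0 f0L] fcvg; apply/cvg_mxP => i j; rewrite ord1 {j}.
apply/cvgrPdist_le => e e0.
(* [c] is the step of the difference quotients. The curvature of [f0] costs at most [c * (e / 2)],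
   and two value errors of [c * e / 4] the rest, for a total of [c * e]. The steps [c] and [- c]
   bound the partial derivative from the two sides. *)
have [c c0 cL] : exists2 c : R, 0 < c & L * c <= e / 2.
  have L1 : 0 < L + 1 by rewrite ltr_wpDl.
  exists (e / (2 * (L + 1))); first by rewrite divr_gt0 // mulr_gt0.
  have -> : L * (e / (2 * (L + 1))) = e / 2 * (L / (L + 1)) by field; rewrite gt_eqF.
  by rewrite ler_piMr ?divr_ge0 ?(ltW e0) // ler_pdivrMr // mul1r lerDl.
have ce : 0 < c * e / 4 by rewrite divr_gt0 // mulr_gt0.
set dl := delta_mx i 0 : 'cV[R]_n.
have /cvgrPdist_le/(_ _ ce) f1 := fcvg (c *: dl).
have /cvgrPdist_le/(_ _ ce) f2 := fcvg (- c *: dl).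
have /cvgrPdist_le/(_ _ ce) f3 := fcvg 0.
near=> t.
have /ler_normlP[h1 h1'] : `|f0 (x0 + c *: dl) - f t (x t + c *: dl)| <= c * e / 4.
  by near: t.
have /ler_normlP[h2 h2'] : `|f0 (x0 + - c *: dl) - f t (x t + - c *: dl)| <= c * e / 4.
  by near: t.
have /ler_normlP[h3 h3'] : `|f0 (x0 + 0) - f t (x t + 0)| <= c * e / 4.
  by near: t.
rewrite !addr0 in h3 h3'.
have fat : strong_grad 0 (f t) (a t) by near: t.
have := fat (x t) (x t + c *: dl); have := fat (x t) (x t + - c *: dl).
have /ler_normlP[k1 k1'] := f0L x0 (x0 + c *: dl).
have /ler_normlP[k2 k2'] := f0L x0 (x0 + - c *: dl).
move: k1 k1' k2 k2'.
rewrite ![_ + _ *: dl - _]addrAC !subrr !add0r !dotZr !dot_delta !normrZ.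
rewrite normrN (gtr0_norm c0) !mul0r !addr0.
have sq : L * (c * `|dl|) ^+ 2 <= c * (e / 2).
  rewrite exprMn; apply: (@le_trans _ _ (L * c ^+ 2)).
    by rewrite ler_wpM2l // ler_piMr ?sqr_ge0 // expr_le1 // norm_delta.
  by rewrite expr2 mulrCA ler_pM2l // mulrC.
move=> k1 k1' k2 k2' l1 l2.
rewrite -(ler_pM2l c0) -[X in X * `|_|](gtr0_norm c0) -normrM.
apply/ler_normlP; split; lra.
Unshelve. all: by end_near. Qed.

(** [minimizer_stability] compares [u t] with a point [w t] that carries the slacks of the limit
    problem; the residual at [w t] tends to the stationarity equation of the limit, which is 0. The
    modulus [s] is the same for all [t], so the bound survives the limit. *)
Lemma minimizer_cvg n r (W : T -> 'M[R]_(r, n)) (b : T -> 'cV[R]_r)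
    (f : T -> 'cV[R]_n -> R^o) (a : T -> 'cV[R]_n -> 'cV[R]_n) (u : T -> 'cV[R]_n)
    (W0 : 'M[R]_(r, n)) (b0 : 'cV[R]_r) (a0 u0 : 'cV[R]_n) (p0 : 'cV[R]_r) s :
  0 < s ->
  (\forall t \near F, [/\ row_free (W t), quad_approx1 (f t) (a t),
     strong_grad s (f t) (a t) & is_minimizer (poly (W t) (b t)) (f t) (u t)]) ->
  row_free W0 -> W @ F --> W0 -> b @ F --> b0 ->
  a0 + W0^T *m p0 = 0 -> min_cv p0 (b0 - W0 *m u0) = 0 ->
  (forall w : T -> 'cV[R]_n, w @ F --> u0 -> a t (w t) @[t --> F] --> a0) ->
  u @ F --> u0.
Proof.
move=> s0 near_t W0free WW0 bb0 kkt1 kkt2 acvg.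
(* Solves [b t - W t *m w t = b0 - W0 *m u0]; the correction to [u0] vanishes in the limit. *)
pose w t := u0 + rinv (W t) *m (b t - b0 + (W0 - W t) *m u0).
have ww0 : w @ F --> u0.
  rewrite -[X in _ --> X]addr0 -(mulmx0 _ (rinv W0)).
  apply: cvgD; first exact: cvg_cst.
  apply: cvg_mulmx; first exact: cvg_rinv.
  have -> : 0 = (b0 - b0) + (W0 - W0) *m u0 by rewrite !subrr mul0mx addr0.
  apply: cvgD; first by apply: cvgB => //; exact: cvg_cst.
  by apply: cvg_mulmx; [apply: cvgB => //; exact: cvg_cst|exact: cvg_cst].
have res0 : a t (w t) + (W t)^T *m p0 @[t --> F] --> (0 : 'cV[R]_n).
  rewrite -kkt1; apply: cvgD; first exact: acvg.
  by apply: cvg_mulmx; [exact: cvg_trmx|exact: cvg_cst].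
have bound : \forall t \near F, `|w t - u t| <= n%:R / s * `|a t (w t) + (W t)^T *m p0|.
  apply: filterS near_t => t [Wf fq fa um].
  have slack : b t - W t *m w t = b0 - W0 *m u0.
    rewrite /w mulmxDr mulmxA mul_rinv // mul1mx mulmxBl.
    by apply/matrixP => i j; rewrite !mxE; ring.
  have := minimizer_stability s0 fq fa um kkt2 slack.
  by rewrite mulrC -ler_pdivlMr // mulrAC.
have wu0 : w t - u t @[t --> F] --> (0 : 'cV[R]_n).
  apply/norm_cvg0P.
  have cvgb : n%:R / s * `|a t (w t) + (W t)^T *m p0| @[t --> F] --> (0 : R).
    rewrite -(mulr0 (n%:R / s)) -(@normr0 _ 'cV[R]_n).
    by apply: cvgMr; exact: cvg_norm.
  apply: squeeze_cvgr (cvg_cst 0) cvgb.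
  by apply: filterS bound => t ->; rewrite normr_ge0.
have -> : u = (fun t => w t - (w t - u t)).
  by apply/funext => t; rewrite opprB addrC subrK.
by rewrite -[X in _ --> X]subr0; apply: cvgB.
Qed.

Section Partial.
Variables (n m k r : nat).
Variables (g : T -> 'cV[R]_n -> 'cV[R]_m -> R^o) (g0 : 'cV[R]_n -> 'cV[R]_m -> R^o).
Variables (a : T -> 'cV[R]_n -> 'cV[R]_m -> 'cV[R]_n) (a0 : 'cV[R]_n -> 'cV[R]_m -> 'cV[R]_n).
Variables (b : T -> 'cV[R]_n -> 'cV[R]_m -> 'cV[R]_m) (b0 : 'cV[R]_n -> 'cV[R]_m -> 'cV[R]_m).
Variables (A : T -> 'M[R]_(r, k)) (A0 : 'M[R]_(r, k)).
Variables (W : T -> 'M[R]_(r, n)) (W0 : 'M[R]_(r, n)).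
Variables (h : T -> 'cV[R]_r) (h0 : 'cV[R]_r).
Variables (x : T -> 'cV[R]_k) (x0 : 'cV[R]_k) (v : T -> 'cV[R]_m) (v0 : 'cV[R]_m) (s : R).
Hypotheses (s_gt0 : 0 < s)
  (near_t : \forall t \near F, [/\ row_free (W t), quad_approx (g t) (a t) (b t) &
     forall v, strongly_convex s ((g t)^~ v)])
  (W0free : row_free W0) (g0q : quad_approx g0 a0 b0)
  (g0s : forall v, strongly_convex s (g0^~ v))
  (AA0 : A @ F --> A0) (WW0 : W @ F --> W0) (hh0 : h @ F --> h0)
  (xx0 : x @ F --> x0)
  (acvg : forall w w0, w @ F --> w0 -> a t (w t) (v t) @[t --> F] --> a0 w0 v0).

Lemma parg_cvg :
  parg (g t) (A t) (W t) (h t) (x t) (v t) @[t --> F] --> parg g0 A0 W0 h0 x0 v0.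
Proof.
have [kkt1 kkt2] := parg_kkt A0 h0 s_gt0 W0free g0q g0s x0 v0.
apply: (minimizer_cvg (f := fun t u => g t u (v t)) (a := fun t u => a t u (v t))
  s_gt0 _ W0free WW0 _ kkt1 kkt2).
- apply: filterS near_t => t [Wf gq gs].
  split => //; [exact: quad_approx_slice gq _|exact: strong_grad_slice gq gs _|].
  exact: parg_minimizer s_gt0 Wf gq gs _ _.
- by apply: cvgB => //; exact: cvg_mulmx.
- by move=> w; exact: acvg.
Qed.

Lemma pmult_cvg :
  pmult (g t) (A t) (W t) (h t) (a t) (x t) (v t) @[t --> F] -->
    pmult g0 A0 W0 h0 a0 x0 v0.
Proof.
apply: cvgN; apply: cvg_mulmx; last exact: acvg parg_cvg.
by apply: cvg_trmx; exact: cvg_rinv.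
Qed.

End Partial.
End Stability.

(** * Almost-sure properties near points of the support *)

Section SupportDensity.
Context {R : realType} {d : measure_display} {Omega : measurableType d}.
Variables (P : probability Omega R) (l : nat) (xi : Omega -> 'cV[R]_l).
Hypothesis xi_rv : random_vector xi.

(** A sup-norm ball is a box, so measurability of the coordinates suffices. *)
Lemma measurable_preimage_ball z (e : R) : 0 < e -> measurable (xi @^-1` ball z e).
Proof.
move=> e0.
have -> : xi @^-1` ball z e =
    \bigcap_(i in [set: 'I_l]) (fun w => xi w i 0) @^-1` ball (z i 0) e.
  apply/seteqP; split => [w [_ zw] i _|w zw]; first exact: zw.
  by split => // i j; rewrite ord1; exact: zw.
apply: fin_bigcap_measurable => // i _.
rewrite -[X in measurable X]setTI; apply: xi_rv => //.
exact: measurable_realfun.measurable_ball.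
Qed.

(** Otherwise a ball around the support point would have its preimage inside a null set, against its
    positive probability. *)
Lemma support_ae_dense (Q : set Omega) z (e : R) : {ae P, forall w, Q w} ->
  support_of P xi z -> 0 < e -> exists2 w, Q w & ball z e (xi w).
Proof.
move=> [N [mN PN0 QN]] zsupp e0; apply: contrapT => noQ.
have := zsupp _ (conj (ball_open z e) (ballxx z e0)).
suff -> : P (xi @^-1` ball z e) = 0%E by rewrite ltxx.
apply: measure_negligible; first exact: measurable_preimage_ball.
exists N; split => // w zw; apply: QN => /= Qw; apply: noQ; by exists w.
Qed.

(** Density makes the trace of the neighbourhood filter on the good scenarios proper, so
    inequalities can be passed to the limit along it. *)
Lemma support_ae_filter (Xi Q : set 'cV[R]_l) z :
  {ae P, forall w, Q (xi w)} -> support_of P xi z -> (forall w, Xi (xi w)) ->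
  exists F : set_system 'cV[R]_l,
    [/\ ProperFilter F, F --> z & \forall z' \near F, (Xi `&` Q) z'].
Proof.
move=> aeQ zsupp xiXi; exists (within (Xi `&` Q) (nbhs z)); split.
- apply: Build_ProperFilter_ex => B /nbhs_ballP[e e0 eB].
  have [w Qw zw] := support_ae_dense aeQ zsupp e0.
  by exists (xi w); apply: eB.
- exact: cvg_within.
- exact: withinT.
Qed.

End SupportDensity.

Lemma strongly_convex_lim (R : realType) n T (F : set_system T) {FF : ProperFilter F}
    (f : T -> 'cV[R]_n -> R^o) (f0 : 'cV[R]_n -> R^o) s :
  (\forall t \near F, strongly_convex s (f t)) -> (forall x, f t x @[t --> F] --> f0 x) ->
  strongly_convex s f0.
Proof.
move=> fs ff0; apply/strongly_convexP => t x y t0 t1.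
rewrite -subr_le0.
pose D (h : 'cV[R]_n -> R) : R := h (t *: x + (1 - t) *: y) -
  (t * h x + (1 - t) * h y - s / 2 * (t * (1 - t)) * sqnorm2 (x - y)).
have Dcvg : D (f u) @[u --> F] --> D f0.
  apply: cvgB; first exact: ff0.
  apply: cvgB; last exact: cvg_cst.
  by apply: cvgD; apply: cvgMr; exact: ff0.
apply: (closed_cvg (fun x : R => x <= 0) (@closed_le R 0) _ _ Dcvg).
apply: filterS fs => u /strongly_convexP/(_ t x y t0 t1).
by rewrite /D subr_le0.
Qed.

Lemma is_min_inf (R : realType) (S : set R) v : is_min S v -> inf S = v.
Proof.
move=> [Sv vS]; apply/eqP; rewrite eq_le; apply/andP; split.
  by apply: ge_inf => //; exists v.
by apply: lb_le_inf => //; exists v.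
Qed.

Lemma is_max_sup (R : realType) (S : set R) v : is_max S v -> sup S = v.
Proof.
move=> [Sv vS]; apply/eqP; rewrite eq_le; apply/andP; split.
  by apply: ge_sup => //; exists v.
by apply: ub_le_sup => //; exists v.
Qed.

Lemma compact_image_bounded (R : realType) (U : topologicalType) (V : normedModType R)
    (f : U -> V) (K : set U) : compact K -> {within K, continuous f} ->
  exists M, forall p, K p -> `|f p| <= M.
Proof.
move=> Kc fc; have [M [_ fM]] := compact_bounded (continuous_compact fc Kc).
by exists (M + 1) => p Kp; apply: (fM _ _ (f p)); [rewrite ltrDl|exists p].
Qed.

Lemma lipschitz_pair (R : realType) (U V W : normedModType R) (A : set U)
    (f : U -> V) (g : U -> W) :
  [lipschitz f x | x in A] -> [lipschitz g x | x in A] -> [lipschitz (f x, g x) | x in A].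
Proof.
move=> /lipschitzP[L L0 fL] /lipschitzP[M M0 gM]; apply/lipschitzP.
exists (L + M) => [|p q Ap Aq]; first by rewrite addr_ge0.
rewrite prod_normE ge_max mulrDl /=; apply/andP; split.
  by apply: le_trans (fL _ _ Ap Aq) _; rewrite lerDl mulr_ge0.
by apply: le_trans (gM _ _ Ap Aq) _; rewrite lerDr mulr_ge0.
Qed.

(** * The second-stage functions and their saddle point *)

Section SecondStageTheory.
Context {R : realType} {n1 m1 n2 m2 l l2 s2 : nat}.
Variable D : second_stage R n1 m1 n2 m2 l l2 s2.
Variables (X1 : set 'cV[R]_n1) (Y1 : set 'cV[R]_m1) (Xi : set 'cV[R]_l) (sigma : R).
Hypotheses (sigma_gt0 : 0 < sigma) (hA : assumptionA D X1 Y1 Xi) (hB : assumptionB D Xi).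
Hypothesis scsc : forall z, Xi z ->
  (forall y2, strongly_convex sigma (fun x2 => F2 D x2 y2 z)) /\
  (forall x2, strongly_concave sigma (fun y2 => F2 D x2 y2 z)).

Let NF2 z (y2 : 'cV[R]_m2) (x2 : 'cV[R]_n2) : R^o := - F2 D x2 y2 z.
Let Fx z x2 y2 := gradl (F2at D z) x2 y2.
Let Fy z x2 y2 := gradr (F2at D z) x2 y2.

Definition ysol z x2 y1 := parg (NF2 z) (matA D z) (matB D z) (vecc D z) y1 x2.

Definition ymult z x2 y1 :=
  pmult (NF2 z) (matA D z) (matB D z) (vecc D z) (fun y x => - Fy z x y) y1 x2.

Definition xsol z x1 y2 := parg (F2at D z) (matT D z) (matW D z) (vech D z) x1 y2.

Definition xmult z x1 y2 :=
  pmult (F2at D z) (matT D z) (matW D z) (vech D z) (Fx z) x1 y2.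

(** Danskin's formula for the gradient of [f21] in [x2]: that of [F2] at the maximizing [y2]. *)
Let f21x z x2 y1 := Fx z x2 (ysol z x2 y1).

Definition saddle_x x1 y1 z := parg (f21 D z) (matT D z) (matW D z) (vech D z) x1 y1.
Definition saddle_y x1 y1 z := ysol z (saddle_x x1 y1 z) y1.
Definition saddle_px x1 y1 z :=
  pmult (f21 D z) (matT D z) (matW D z) (vech D z) (f21x z) x1 y1.
Definition saddle_py x1 y1 z := ymult z (saddle_x x1 y1 z) y1.

Lemma X2_fiber x1 z : X2 D x1 z = fiber (matT D z) (matW D z) (vech D z) x1.
Proof.
by apply/seteqP; split => x2 h i; have := h i; rewrite !mxE ?lerBrDl // -lerBrDl.
Qed.

Lemma Y2_fiber y1 z : Y2 D y1 z = fiber (matA D z) (matB D z) (vecc D z) y1.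
Proof.
by apply/seteqP; split => x2 h i; have := h i; rewrite !mxE ?lerBrDl // -lerBrDl.
Qed.

Section FixedScenario.
Variable z : 'cV[R]_l.
Hypothesis Xiz : Xi z.

Lemma quad_approx_F2 : quad_approx (F2at D z) (Fx z) (Fy z).
Proof.
exact: C1_quad_approx (F2_C1 hA Xiz) (F2_lipschitz_gradient hA Xiz).
Qed.

Lemma F2_sc y2 : strongly_convex sigma ((F2at D z)^~ y2).
Proof. exact: (scsc Xiz).1. Qed.

Lemma quad_approx_NF2 :
  quad_approx (NF2 z) (fun y x => - Fy z x y) (fun y x => - Fx z x y).
Proof. exact: quad_approx_swap (quad_approxN quad_approx_F2). Qed.

Lemma NF2_sc x2 : strongly_convex sigma ((NF2 z)^~ x2).
Proof. exact: (scsc Xiz).2. Qed.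

Lemma NF2_scc y2 : strongly_concave sigma (NF2 z y2).
Proof.
rewrite /strongly_concave /NF2; under eq_fun do rewrite opprK.
exact: F2_sc.
Qed.

Lemma matB_free : row_free (matB D z). Proof. exact: (full_row_rank hA Xiz).1. Qed.
Lemma matW_free : row_free (matW D z). Proof. exact: (full_row_rank hA Xiz).2. Qed.

Lemma ysol_feasible x2 y1 : Y2 D y1 z (ysol z x2 y1).
Proof.
rewrite Y2_fiber.
exact: (parg_minimizer _ _ sigma_gt0 matB_free quad_approx_NF2 NF2_sc _ _).1.
Qed.

Lemma ysol_max x2 y1 y2 : Y2 D y1 z y2 -> F2 D x2 y2 z <= F2 D x2 (ysol z x2 y1) z.
Proof.
rewrite Y2_fiber => Yy.
have := (parg_minimizer _ _ sigma_gt0 matB_free quad_approx_NF2 NF2_sc _ x2).2 _ Yy.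
by rewrite lerN2.
Qed.

Lemma f21_ysol x2 y1 : f21 D z x2 y1 = F2 D x2 (ysol z x2 y1) z.
Proof.
apply: is_max_sup; split; first by exists (ysol z x2 y1) => //; exact: ysol_feasible.
by move=> _ [y2 Yy <-]; exact: ysol_max.
Qed.

Lemma is_max_f21 x2 y1 : is_max [set F2 D x2 y2 z | y2 in Y2 D y1 z] (f21 D z x2 y1).
Proof.
rewrite f21_ysol; split; first by exists (ysol z x2 y1) => //; exact: ysol_feasible.
by move=> _ [y2 Yy <-]; exact: ysol_max.
Qed.

Lemma f21E : f21 D z = fun x2 y1 => - pmin (NF2 z) (matA D z) (matB D z) (vecc D z) y1 x2.
Proof.
by apply/funext => x2; apply/funext => y1; rewrite f21_ysol /pmin /NF2 opprK.
Qed.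

Lemma quad_approx_f21 :
  quad_approx (f21 D z) (f21x z) (fun x2 y1 => - ((matA D z)^T *m ymult z x2 y1)).
Proof.
have := quad_approx_swap (quad_approxN (quad_approx_pmin (matA D z) (vecc D z)
  sigma_gt0 matB_free quad_approx_NF2 NF2_sc)).
(* One sign comes from minimizing [- F2], the other from negating its minimum. *)
have -> : f21x z = (fun x2 y1 => - - f21x z x2 y1).
  by apply/funext => x2; apply/funext => y1; rewrite opprK.
by rewrite f21E.
Qed.

(** The set [Y2 D y1 z] does not depend on [x2], so [- f21] is an infimum of [sigma]-strongly
    concave functions over a fixed set. *)
Lemma f21_sc y1 : strongly_convex sigma (fun x2 => f21 D z x2 y1).
Proof.
rewrite f21E.
exact: (pmin_concave (matA D z) (vecc D z) sigma_gt0 matB_free quad_approx_NF2 NF2_sc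
  y1 NF2_scc).
Qed.

Lemma f21_concave x2 : concave_function (f21 D z x2).
Proof.
apply/concave_functionP; rewrite f21E /strongly_concave; under eq_fun do rewrite opprK.
exact: pmin_convex sigma_gt0 matB_free quad_approx_NF2 NF2_sc _.
Qed.

Lemma xsol_feasible x1 y2 : X2 D x1 z (xsol z x1 y2).
Proof.
rewrite X2_fiber.
exact: (parg_minimizer _ _ sigma_gt0 matW_free quad_approx_F2 F2_sc _ _).1.
Qed.

Lemma xsol_min x1 y2 x2 : X2 D x1 z x2 -> F2 D (xsol z x1 y2) y2 z <= F2 D x2 y2 z.
Proof.
rewrite X2_fiber => Xx.
exact: ((parg_minimizer _ _ sigma_gt0 matW_free quad_approx_F2 F2_sc _ y2).2 _ Xx).
Qed.

Lemma f22_xsol x1 y2 : f22 D z x1 y2 = F2 D (xsol z x1 y2) y2 z.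
Proof.
apply: is_min_inf; split; first by exists (xsol z x1 y2) => //; exact: xsol_feasible.
by move=> _ [x2 Xx <-]; exact: xsol_min.
Qed.

Lemma is_min_f22 x1 y2 : is_min [set F2 D x2 y2 z | x2 in X2 D x1 z] (f22 D z x1 y2).
Proof.
rewrite f22_xsol; split; first by exists (xsol z x1 y2) => //; exact: xsol_feasible.
by move=> _ [x2 Xx <-]; exact: xsol_min.
Qed.

Lemma f22E : f22 D z = pmin (F2at D z) (matT D z) (matW D z) (vech D z).
Proof. by apply/funext => x1; apply/funext => y2; rewrite f22_xsol. Qed.

Lemma quad_approx_f22 : quad_approx (f22 D z)
  (fun x1 y2 => (matT D z)^T *m xmult z x1 y2) (fun x1 y2 => Fy z (xsol z x1 y2) y2).
Proof.
rewrite f22E.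
have := quad_approx_pmin (matT D z) (vech D z) sigma_gt0 matW_free quad_approx_F2 F2_sc.
exact.
Qed.

Lemma f22_convex y2 : convex_function setT (fun x1 => f22 D z x1 y2).
Proof.
apply/convex_functionP; rewrite f22E.
exact: pmin_convex sigma_gt0 matW_free quad_approx_F2 F2_sc _.
Qed.

Lemma f22_scc x1 : strongly_concave sigma (f22 D z x1).
Proof.
rewrite f22E; apply: (pmin_concave (matT D z) (vech D z) sigma_gt0 matW_free
  quad_approx_F2 F2_sc).
exact: (scsc Xiz).2.
Qed.

Lemma is_min_psi2_pmin x1 y1 : is_min [set f21 D z x2 y1 | x2 in X2 D x1 z]
  (pmin (f21 D z) (matT D z) (matW D z) (vech D z) x1 y1).
Proof.
rewrite X2_fiber; exact: is_min_pmin sigma_gt0 matW_free quad_approx_f21 f21_sc _ _.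
Qed.

Lemma psi2E : psi2 D z = pmin (f21 D z) (matT D z) (matW D z) (vech D z).
Proof.
by apply/funext => x1; apply/funext => y1; apply: is_min_inf; exact: is_min_psi2_pmin.
Qed.

Lemma is_min_psi2 x1 y1 :
  is_min [set f21 D z x2 y1 | x2 in X2 D x1 z] (psi2 D z x1 y1).
Proof. by rewrite psi2E; exact: is_min_psi2_pmin. Qed.

Lemma quad_approx_psi2 : quad_approx (psi2 D z)
  (fun x1 y1 => (matT D z)^T *m saddle_px x1 y1 z)
  (fun x1 y1 => - ((matA D z)^T *m saddle_py x1 y1 z)).
Proof.
rewrite psi2E.
have := quad_approx_pmin (matT D z) (vech D z) sigma_gt0 matW_free quad_approx_f21 f21_sc.
exact.
Qed.

Lemma psi2_convex y1 : convex_function setT (fun x1 => psi2 D z x1 y1).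
Proof.
apply/convex_functionP; rewrite psi2E.
exact: pmin_convex sigma_gt0 matW_free quad_approx_f21 f21_sc _.
Qed.

Lemma psi2_concave x1 : concave_function (psi2 D z x1).
Proof.
apply/concave_functionP; rewrite psi2E.
apply: (pmin_concave (matT D z) (vech D z) sigma_gt0 matW_free quad_approx_f21 f21_sc).
by move=> u; apply/concave_functionP; exact: f21_concave.
Qed.

(** The four blocks are the KKT system of the outer problem for [f21] and that of the inner problem
    at [saddle_x]; they fit together because [f21x] at [saddle_x] is the partial gradient of [F2] at
    the saddle pair. *)
Lemma saddle_KKT x1 y1 : H D x1 y1 z (saddle_x x1 y1 z) (saddle_y x1 y1 z)
  (saddle_px x1 y1 z) (saddle_py x1 y1 z) = 0.
Proof.
have [kx1 kx2] := parg_kkt (matT D z) (vech D z) sigma_gt0 matW_free quad_approx_f21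
  f21_sc x1 y1.
have [ky1 ky2] := parg_kkt (matA D z) (vecc D z) sigma_gt0 matB_free quad_approx_NF2
  NF2_sc y1 (saddle_x x1 y1 z).
by rewrite /H kx1 kx2 ky1 ky2 !col_mx0.
Qed.

Lemma saddle_minimizer x1 y1 :
  is_minimizer (fiber (matT D z) (matW D z) (vech D z) x1) (fun x2 => f21 D z x2 y1)
    (saddle_x x1 y1 z).
Proof. exact: parg_minimizer sigma_gt0 matW_free quad_approx_f21 f21_sc _ _. Qed.

(* Optimality of [saddle_x] for [f21] is a variational inequality for the gradient
   of [F2] at the saddle point, by Danskin's formula. *)
Lemma saddle_is_saddle x1 y1 : is_saddle_point (X2 D x1 z) (Y2 D y1 z) (F2at D z)
  (saddle_x x1 y1 z, saddle_y x1 y1 z).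
Proof.
have xmin := saddle_minimizer x1 y1.
split => /=; [|exact: ysol_feasible|exact: ysol_max|].
  by rewrite X2_fiber; exact: xmin.1.
move=> x2; rewrite X2_fiber => Xx.
have := minimizer_VI (@poly_segment_closed _ _ _ _ _)
  (quad_approx_slice quad_approx_f21 y1) xmin Xx.
have := strong_grad_slice quad_approx_F2 F2_sc (saddle_y x1 y1 z) (saddle_x x1 y1 z) x2.
have := mulr_ge0 (ltW sigma_gt0) (sqnorm2_ge0 (x2 - saddle_x x1 y1 z)).
rewrite /f21x -/(saddle_y x1 y1 z); lra.
Qed.

(** The second component must be the inner maximizer at [px]. The first then minimizes [f21], by
    [f21 px = F2 px py <= F2 x py <= f21 x], and both minimizers are unique. *)
Lemma saddle_unique x1 y1 p :
  is_saddle_point (X2 D x1 z) (Y2 D y1 z) (F2at D z) p ->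
  p = (saddle_x x1 y1 z, saddle_y x1 y1 z).
Proof.
case: p => px py [/= Xp Yp pmax pmn].
have pyE : py = ysol z px y1.
  apply: (parg_unique sigma_gt0 matB_free quad_approx_NF2 NF2_sc).
  rewrite -Y2_fiber; split => // y Yy; rewrite lerN2; exact: pmax.
suff pxE : px = saddle_x x1 y1 z by rewrite pyE pxE.
apply: (parg_unique sigma_gt0 matW_free quad_approx_f21 f21_sc).
rewrite -X2_fiber; split => // x Xx.
rewrite {1}f21_ysol -pyE; apply: le_trans (pmn _ Xx) _.
by rewrite f21_ysol; exact: ysol_max.
Qed.

Lemma lip2_ysol : lip2 (ysol z).
Proof.
have [L L0 yL] := lip2_parg (matA D z) (vecc D z) sigma_gt0 matB_free quad_approx_NF2 NF2_sc.
by exists L => // x y x' y'; rewrite [`|x' - x| + _]addrC; exact: yL.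
Qed.

Lemma lip2_ymult : lip2 (ymult z).
Proof.
have [L L0 yL] := lip2_pmult (matA D z) (vecc D z) sigma_gt0 matB_free quad_approx_NF2 NF2_sc.
by exists L => // x y x' y'; rewrite [`|x' - x| + _]addrC; exact: yL.
Qed.

Lemma lip2_saddle_x : lip2 (fun x1 y1 => saddle_x x1 y1 z).
Proof. exact: lip2_parg sigma_gt0 matW_free quad_approx_f21 f21_sc. Qed.

Lemma lip2_saddle_px : lip2 (fun x1 y1 => saddle_px x1 y1 z).
Proof. exact: lip2_pmult sigma_gt0 matW_free quad_approx_f21 f21_sc. Qed.

Lemma lip2_saddle_y : lip2 (fun x1 y1 => saddle_y x1 y1 z).
Proof. exact: lip2_comp lip2_ysol lip2_saddle_x (lip2_snd _ _ _). Qed.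

Lemma lip2_saddle_py : lip2 (fun x1 y1 => saddle_py x1 y1 z).
Proof. exact: lip2_comp lip2_ymult lip2_saddle_x (lip2_snd _ _ _). Qed.

Lemma saddle_lipschitz (A : set ('cV[R]_n1 * 'cV[R]_m1)) :
  [lipschitz (saddle_x p.1 p.2 z, saddle_y p.1 p.2 z,
              saddle_px p.1 p.2 z, saddle_py p.1 p.2 z) | p in A].
Proof.
have sub k (f : 'cV[R]_n1 -> 'cV[R]_m1 -> 'cV[R]_k) :
    lip2 f -> [lipschitz f p.1 p.2 | p in A].
  move=> /lip2_lipschitz/lipschitzP[L L0 fL]; apply/lipschitzP.
  by exists L => // p q _ _; exact: fL.
apply: lipschitz_pair; last exact: sub lip2_saddle_py.
apply: lipschitz_pair; last exact: sub lip2_saddle_px.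
apply: lipschitz_pair; last exact: sub lip2_saddle_y.
exact: sub lip2_saddle_x.
Qed.

End FixedScenario.

(** * Continuity with respect to the scenario *)

Section VaryingScenario.
Context {T : Type} {F : set_system T} {FF : Filter F}.
Variables (zt : T -> 'cV[R]_l) (z : 'cV[R]_l).
Hypotheses (Xiz : Xi z) (Xizt : \forall t \near F, Xi (zt t)) (zz : zt @ F --> z).

Lemma F2_cvg (xt : T -> 'cV[R]_n2) (x : 'cV[R]_n2) (yt : T -> 'cV[R]_m2) (y : 'cV[R]_m2) :
  xt @ F --> x -> yt @ F --> y ->
  F2 D (xt t) (yt t) (zt t) @[t --> F] --> F2 D x y z.
Proof.
move=> xx yy.
apply: (within_cvg (u := fun t => (xt t, yt t, zt t)) (u0 := (x, y, z)) (F2_continuous hA)) => //.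
exact: (cvg_pair (cvg_pair xx yy) zz).
Qed.

(** Continuity of the gradient in the scenario comes from that of the values of [F2], through
    convexity in [x2]; concavity in [y2] serves the other block in the same way. *)
Lemma Fx_cvg (xt : T -> 'cV[R]_n2) (x : 'cV[R]_n2) (yt : T -> 'cV[R]_m2) (y : 'cV[R]_m2) :
  xt @ F --> x -> yt @ F --> y ->
  Fx (zt t) (xt t) (yt t) @[t --> F] --> Fx z x y.
Proof.
move=> xx yy.
apply: (grad_cvg (f := fun t x2 => F2at D (zt t) x2 (yt t)) (f0 := fun x2 => F2at D z x2 y)
  (a := fun t x2 => Fx (zt t) x2 (yt t)) (a0 := fun x2 => Fx z x2 y)).
- apply: filterS Xizt => t Xit; apply: strong_gradW (ltW sigma_gt0) _.
  exact: strong_grad_slice (quad_approx_F2 Xit) (F2_sc Xit) _.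
- exact: quad_approx_slice (quad_approx_F2 Xiz) _.
- by move=> d; apply: F2_cvg => //; apply: cvgD => //; exact: cvg_cst.
Qed.

Lemma NFy_cvg (xt : T -> 'cV[R]_n2) (x : 'cV[R]_n2) (yt : T -> 'cV[R]_m2) (y : 'cV[R]_m2) :
  xt @ F --> x -> yt @ F --> y ->
  - Fy (zt t) (xt t) (yt t) @[t --> F] --> - Fy z x y.
Proof.
move=> xx yy.
apply: (grad_cvg (f := fun t y2 => NF2 (zt t) y2 (xt t)) (f0 := fun y2 => NF2 z y2 x)
  (a := fun t y2 => - Fy (zt t) (xt t) y2) (a0 := fun y2 => - Fy z x y2)).
- apply: filterS Xizt => t Xit; apply: strong_gradW (ltW sigma_gt0) _.
  exact: strong_grad_slice (quad_approx_NF2 Xit) (NF2_sc Xit) _.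
- exact: quad_approx_slice (quad_approx_NF2 Xiz) _.
- move=> d; apply: cvgN; apply: F2_cvg => //.
  by apply: cvgD => //; exact: cvg_cst.
Qed.

Lemma Fy_cvg (xt : T -> 'cV[R]_n2) (x : 'cV[R]_n2) (yt : T -> 'cV[R]_m2) (y : 'cV[R]_m2) :
  xt @ F --> x -> yt @ F --> y ->
  Fy (zt t) (xt t) (yt t) @[t --> F] --> Fy z x y.
Proof.
move=> xx yy; rewrite -(opprK (Fy z x y)).
have -> : (fun t => Fy (zt t) (xt t) (yt t)) = (fun t => - - Fy (zt t) (xt t) (yt t)).
  by apply/funext => t; rewrite opprK.
by apply: cvgN; exact: NFy_cvg.
Qed.

Let matT_cvg : matT D (zt t) @[t --> F] --> matT D z.
Proof. exact: (within_cvg (matT_continuous hB)). Qed.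
Let matW_cvg : matW D (zt t) @[t --> F] --> matW D z.
Proof. exact: (within_cvg (matW_continuous hB)). Qed.
Let vech_cvg : vech D (zt t) @[t --> F] --> vech D z.
Proof. exact: (within_cvg (vech_continuous hB)). Qed.
Let matA_cvg : matA D (zt t) @[t --> F] --> matA D z.
Proof. exact: (within_cvg (matA_continuous hB)). Qed.
Let matB_cvg : matB D (zt t) @[t --> F] --> matB D z.
Proof. exact: (within_cvg (matB_continuous hB)). Qed.
Let vecc_cvg : vecc D (zt t) @[t --> F] --> vecc D z.
Proof. exact: (within_cvg (vecc_continuous hB)). Qed.

Section Inner.
Variables (xt : T -> 'cV[R]_n2) (x : 'cV[R]_n2) (yt : T -> 'cV[R]_m1) (y : 'cV[R]_m1).
Hypotheses (xx : xt @ F --> x) (yy : yt @ F --> y).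

Let near_NF2 : \forall t \near F, [/\ row_free (matB D (zt t)),
  quad_approx (NF2 (zt t)) (fun y x => - Fy (zt t) x y) (fun y x => - Fx (zt t) x y) &
  forall v, strongly_convex sigma ((NF2 (zt t))^~ v)].
Proof.
apply: filterS Xizt => t Xit.
by split; [exact: matB_free|exact: quad_approx_NF2|exact: NF2_sc].
Qed.

Lemma ysol_cvg : ysol (zt t) (xt t) (yt t) @[t --> F] --> ysol z x y.
Proof.
apply: (parg_cvg sigma_gt0 near_NF2 (matB_free Xiz) (quad_approx_NF2 Xiz) (NF2_sc Xiz)) => //.
by move=> w w0 ww; exact: NFy_cvg.
Qed.

Lemma ymult_cvg : ymult (zt t) (xt t) (yt t) @[t --> F] --> ymult z x y.
Proof.
apply: (pmult_cvg sigma_gt0 near_NF2 (matB_free Xiz) (quad_approx_NF2 Xiz) (NF2_sc Xiz)) => //.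
by move=> w w0 ww; exact: NFy_cvg.
Qed.

End Inner.

Section Outer.
Variables (xt : T -> 'cV[R]_n1) (x : 'cV[R]_n1).
Hypotheses (xx : xt @ F --> x).

Let near_F2 : \forall t \near F, [/\ row_free (matW D (zt t)),
  quad_approx (F2at D (zt t)) (Fx (zt t)) (Fy (zt t)) &
  forall v, strongly_convex sigma ((F2at D (zt t))^~ v)].
Proof.
apply: filterS Xizt => t Xit.
by split; [exact: matW_free|exact: quad_approx_F2|exact: F2_sc].
Qed.

Lemma xsol_cvg (yt : T -> 'cV[R]_m2) (y : 'cV[R]_m2) : yt @ F --> y ->
  xsol (zt t) (xt t) (yt t) @[t --> F] --> xsol z x y.
Proof.
move=> yy.
apply: (parg_cvg sigma_gt0 near_F2 (matW_free Xiz) (quad_approx_F2 Xiz) (F2_sc Xiz)) => //.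
by move=> w w0 ww; exact: Fx_cvg.
Qed.

Lemma xmult_cvg (yt : T -> 'cV[R]_m2) (y : 'cV[R]_m2) : yt @ F --> y ->
  xmult (zt t) (xt t) (yt t) @[t --> F] --> xmult z x y.
Proof.
move=> yy.
apply: (pmult_cvg sigma_gt0 near_F2 (matW_free Xiz) (quad_approx_F2 Xiz) (F2_sc Xiz)) => //.
by move=> w w0 ww; exact: Fx_cvg.
Qed.

Variables (yt : T -> 'cV[R]_m1) (y : 'cV[R]_m1).
Hypothesis yy : yt @ F --> y.

Let near_f21 : \forall t \near F, [/\ row_free (matW D (zt t)),
  quad_approx (f21 D (zt t)) (f21x (zt t))
    (fun x2 y1 => - ((matA D (zt t))^T *m ymult (zt t) x2 y1)) &
  forall v, strongly_convex sigma ((f21 D (zt t))^~ v)].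
Proof.
apply: filterS Xizt => t Xit.
by split; [exact: matW_free|exact: quad_approx_f21|exact: f21_sc].
Qed.

Let f21x_cvg (w : T -> 'cV[R]_n2) (w0 : 'cV[R]_n2) : w @ F --> w0 ->
  f21x (zt t) (w t) (yt t) @[t --> F] --> f21x z w0 y.
Proof. by move=> ww; apply: Fx_cvg => //; exact: ysol_cvg. Qed.

Lemma saddle_x_cvg : saddle_x (xt t) (yt t) (zt t) @[t --> F] --> saddle_x x y z.
Proof.
exact: (parg_cvg sigma_gt0 near_f21 (matW_free Xiz) (quad_approx_f21 Xiz) (f21_sc Xiz)).
Qed.

Lemma saddle_px_cvg : saddle_px (xt t) (yt t) (zt t) @[t --> F] --> saddle_px x y z.
Proof.
exact: (pmult_cvg sigma_gt0 near_f21 (matW_free Xiz) (quad_approx_f21 Xiz) (f21_sc Xiz)).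
Qed.

Lemma saddle_y_cvg : saddle_y (xt t) (yt t) (zt t) @[t --> F] --> saddle_y x y z.
Proof. by apply: ysol_cvg => //; exact: saddle_x_cvg. Qed.

Lemma saddle_py_cvg : saddle_py (xt t) (yt t) (zt t) @[t --> F] --> saddle_py x y z.
Proof. by apply: ymult_cvg => //; exact: saddle_x_cvg. Qed.

End Outer.

Lemma gradl_f21_cvg x y : gradl (f21 D (zt t)) x y @[t --> F] --> gradl (f21 D z) x y.
Proof.
rewrite (quad_approx_gradl _ _ (quad_approx_f21 Xiz)).
have : f21x (zt t) x y @[t --> F] --> f21x z x y.
  apply: Fx_cvg; first exact: cvg_cst.
  by apply: ysol_cvg; exact: cvg_cst.
(* The explicit gradient formula holds only for scenarios in [Xi], so the two maps agree only
   eventually along [F]. *)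
move=> lim; apply: cvg_trans lim; apply: near_eq_cvg; apply: filterS Xizt => t Xit.
by rewrite (quad_approx_gradl _ _ (quad_approx_f21 Xit)).
Qed.

Lemma gradr_f21_cvg x y : gradr (f21 D (zt t)) x y @[t --> F] --> gradr (f21 D z) x y.
Proof.
rewrite (quad_approx_gradr _ _ (quad_approx_f21 Xiz)).
have : - ((matA D (zt t))^T *m ymult (zt t) x y) @[t --> F] -->
    - ((matA D z)^T *m ymult z x y).
  apply: cvgN; apply: cvg_mulmx; first exact: cvg_trmx.
  by apply: ymult_cvg; exact: cvg_cst.
move=> lim; apply: cvg_trans lim; apply: near_eq_cvg; apply: filterS Xizt => t Xit.
by rewrite (quad_approx_gradr _ _ (quad_approx_f21 Xit)).
Qed.

Lemma gradl_f22_cvg x y : gradl (f22 D (zt t)) x y @[t --> F] --> gradl (f22 D z) x y.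
Proof.
rewrite (quad_approx_gradl _ _ (quad_approx_f22 Xiz)).
have : (matT D (zt t))^T *m xmult (zt t) x y @[t --> F] --> (matT D z)^T *m xmult z x y.
  apply: cvg_mulmx; first exact: cvg_trmx.
  by apply: xmult_cvg; exact: cvg_cst.
move=> lim; apply: cvg_trans lim; apply: near_eq_cvg; apply: filterS Xizt => t Xit.
by rewrite (quad_approx_gradl _ _ (quad_approx_f22 Xit)).
Qed.

Lemma gradr_f22_cvg x y : gradr (f22 D (zt t)) x y @[t --> F] --> gradr (f22 D z) x y.
Proof.
rewrite (quad_approx_gradr _ _ (quad_approx_f22 Xiz)).
have : Fy (zt t) (xsol (zt t) x y) y @[t --> F] --> Fy z (xsol z x y) y.
  apply: Fy_cvg; last exact: cvg_cst.
  by apply: xsol_cvg; exact: cvg_cst.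
move=> lim; apply: cvg_trans lim; apply: near_eq_cvg; apply: filterS Xizt => t Xit.
by rewrite (quad_approx_gradr _ _ (quad_approx_f22 Xit)).
Qed.

End VaryingScenario.

End SecondStageTheory.

(** * Passage to the whole support and choice of the compact sets *)

Theorem lemma3p1 (R : realType) (d : measure_display) (Omega : measurableType d)
    (P : probability Omega R) (n1 m1 n2 m2 l l2 s2 : nat)
    (xi : Omega -> 'cV[R]_l) (Xi : set 'cV[R]_l)
    (X1 : set 'cV[R]_n1) (Y1 : set 'cV[R]_m1)
    (D : second_stage R n1 m1 n2 m2 l l2 s2) (sigma : R)
    (xi_rv : random_vector xi)
    (Xi_support : Xi = support_of P xi)
    (xi_Xi : forall w, Xi (xi w))
    (X1_convex : convex_set X1) (X1_compact : compact X1)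
    (Y1_convex : convex_set Y1) (Y1_compact : compact Y1)
    (sigma_gt0 : 0 < sigma)
    (F2_scsc : {ae P, forall w,
       (forall y2, strongly_convex sigma (fun x2 => F2 D x2 y2 (xi w))) /\
       (forall x2, strongly_concave sigma (fun y2 => F2 D x2 y2 (xi w)))})
    (hA : assumptionA D X1 Y1 Xi) (hB : assumptionB D Xi) :
  [/\
    (* (i) *)
    [/\ (forall z x2 y1, Xi z ->
           is_max [set F2 D x2 y2 z | y2 in Y2 D y1 z] (f21 D z x2 y1)),
        (forall z, Xi z ->
           [/\ continuously_differentiable (f21 D z),
               (exists2 s, 0 < s &
                  forall y1, strongly_convex s (fun x2 => f21 D z x2 y1)),
               (forall x2, concave_function (f21 D z x2)) &
               lipschitz_gradient (f21 D z)]) &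
        (forall x2 y1,
           {within Xi, continuous (fun z => gradr (f21 D z) x2 y1)} /\
           {within Xi, continuous (fun z => gradl (f21 D z) x2 y1)})],
    (* (ii) *)
    [/\ (forall z x1 y2, Xi z ->
           is_min [set F2 D x2 y2 z | x2 in X2 D x1 z] (f22 D z x1 y2)),
        (forall z, Xi z ->
           [/\ continuously_differentiable (f22 D z),
               (forall y2, convex_function setT (fun x1 => f22 D z x1 y2)),
               (exists2 s, 0 < s &
                  forall x1, strongly_concave s (f22 D z x1)) &
               lipschitz_gradient (f22 D z)]) &
        (forall x1 y2,
           {within Xi, continuous (fun z => gradl (f22 D z) x1 y2)} /\
           {within Xi, continuous (fun z => gradr (f22 D z) x1 y2)})],
    (* (iii), regularity of psi2 *)
    (forall z, Xi z ->
       [/\ (forall x1 y1,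
              is_min [set f21 D z x2 y1 | x2 in X2 D x1 z] (psi2 D z x1 y1)),
           (forall y1, convex_function setT (fun x1 => psi2 D z x1 y1)),
           (forall x1, concave_function (psi2 D z x1)) &
           continuously_differentiable (psi2 D z)]) &
    (* (iii), saddle point and multipliers, and (iv) *)
    exists (xbar : 'cV[R]_n1 -> 'cV[R]_m1 -> 'cV[R]_l -> 'cV[R]_n2)
           (ybar : 'cV[R]_n1 -> 'cV[R]_m1 -> 'cV[R]_l -> 'cV[R]_m2)
           (pix : 'cV[R]_n1 -> 'cV[R]_m1 -> 'cV[R]_l -> 'cV[R]_l2)
           (piy : 'cV[R]_n1 -> 'cV[R]_m1 -> 'cV[R]_l -> 'cV[R]_s2),
    [/\ (forall x1 y1 z, X1 x1 -> Y1 y1 -> Xi z ->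
           [/\ H D x1 y1 z (xbar x1 y1 z) (ybar x1 y1 z)
                           (pix x1 y1 z) (piy x1 y1 z) = 0,
               gradl (psi2 D z) x1 y1 = (matT D z)^T *m pix x1 y1 z,
               gradr (psi2 D z) x1 y1 = - ((matA D z)^T *m piy x1 y1 z),
               is_saddle_point (X2 D x1 z) (Y2 D y1 z) (F2at D z)
                 (xbar x1 y1 z, ybar x1 y1 z) &
               forall p, is_saddle_point (X2 D x1 z) (Y2 D y1 z) (F2at D z) p ->
                 p = (xbar x1 y1 z, ybar x1 y1 z)]),
        (forall z, Xi z ->
           [lipschitz (xbar p.1 p.2 z, ybar p.1 p.2 z,
                       pix p.1 p.2 z, piy p.1 p.2 z) | p in X1 `*` Y1]),
        (forall x1 y1, X1 x1 -> Y1 y1 ->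
           {within Xi, continuous (fun z =>
              (xbar x1 y1 z, ybar x1 y1 z, pix x1 y1 z, piy x1 y1 z))}) &
        (* (iv) *)
        exists (hatX : set 'cV[R]_n2) (hatY : set 'cV[R]_m2),
        [/\ convex_set hatX /\ compact hatX,
            convex_set hatY /\ compact hatY,
            (forall x1 y1 z, X1 x1 -> Y1 y1 -> Xi z ->
               (hatX `*` hatY) (xbar x1 y1 z, ybar x1 y1 z)) &
            exists (checkX : set 'cV[R]_n2) (checkY : set 'cV[R]_m2),
            [/\ convex_set checkX /\ compact checkX,
                convex_set checkY /\ compact checkY,
                hatX `<=` checkX /\ hatY `<=` checkY,
                (forall x2 y1 z, hatX x2 -> Y1 y1 -> Xi z ->
                   is_max [set F2 D x2 y2 z | y2 in Y2 D y1 z `&` checkY]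
                     (f21 D z x2 y1)) &
                (forall x1 y2 z, X1 x1 -> hatY y2 -> Xi z ->
                   is_min [set F2 D x2 y2 z | x2 in X2 D x1 z `&` checkX]
                     (f22 D z x1 y2))]]]].
Proof.
(* Strong convexity-concavity at an arbitrary support point, as a limit along good scenarios in
   [Xi], where [F2] is continuous. *)
have sc z : Xi z -> (forall y2, strongly_convex sigma (fun x2 => F2 D x2 y2 z)) /\
    (forall x2, strongly_concave sigma (fun y2 => F2 D x2 y2 z)).
  move=> Xiz; have zsupp := Xiz; rewrite Xi_support in zsupp.
  pose Q z' := (forall y2, strongly_convex sigma (fun x2 => F2 D x2 y2 z')) /\
    (forall x2, strongly_concave sigma (fun y2 => F2 D x2 y2 z')).
  have [F [FF Fz nearXiQ]] := support_ae_filter xi_rv (Q := Q) F2_scsc zsupp xi_Xi.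
  have nearXi : \forall z' \near F, Xi z' by apply: filterS nearXiQ => z' [].
  have F2lim x2 y2 : F2 D x2 y2 z' @[z' --> F] --> F2 D x2 y2 z.
    by apply: (F2_cvg hA Xiz nearXi Fz); exact: cvg_cst.
  split=> [y2|x2].
    apply: (strongly_convex_lim _ (fun x2 => F2lim x2 y2)).
    by apply: filterS nearXiQ => z' [_ [scl _]]; exact: scl.
  apply: (strongly_convex_lim _ (fun y2 => cvgN (F2lim x2 y2))).
  by apply: filterS nearXiQ => z' [_ [_ scr]]; exact: scr.
split.
- split.
  + by move=> z x2 y1 Xiz; exact: (is_max_f21 sigma_gt0 hA sc).
  + move=> z Xiz; have [fC1 flip] := quad_approx_C1 (quad_approx_f21 sigma_gt0 hA sc Xiz).
    split => //; last by move=> x2; exact: (f21_concave sigma_gt0 hA sc).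
    by exists sigma => // y1; exact: (f21_sc sigma_gt0 hA sc).
  + move=> x2 y1; split; apply: cvg_within_continuous => z F FF Xiz nXi Fz.
      exact: (gradr_f21_cvg sigma_gt0 hA hB sc).
    exact: (gradl_f21_cvg sigma_gt0 hA hB sc).
- split.
  + by move=> z x1 y2 Xiz; exact: (is_min_f22 sigma_gt0 hA sc).
  + move=> z Xiz; have [fC1 flip] := quad_approx_C1 (quad_approx_f22 sigma_gt0 hA sc Xiz).
    split => //; first by move=> y2; exact: (f22_convex sigma_gt0 hA sc).
    by exists sigma => // x1; exact: (f22_scc sigma_gt0 hA sc).
  + move=> x1 y2; split; apply: cvg_within_continuous => z F FF Xiz nXi Fz.
      exact: (gradl_f22_cvg sigma_gt0 hA hB sc).
    exact: (gradr_f22_cvg sigma_gt0 hA hB sc).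
- move=> z Xiz; split.
  + by move=> x1 y1; exact: (is_min_psi2 sigma_gt0 hA sc).
  + by move=> y1; exact: (psi2_convex sigma_gt0 hA sc).
  + by move=> x1; exact: (psi2_concave sigma_gt0 hA sc).
  + exact: (quad_approx_C1 (quad_approx_psi2 sigma_gt0 hA sc Xiz)).1.
exists (saddle_x D), (saddle_y D), (saddle_px D), (saddle_py D); split.
- move=> x1 y1 z _ _ Xiz; have psiq := quad_approx_psi2 sigma_gt0 hA sc Xiz; split.
  + exact: (saddle_KKT sigma_gt0 hA sc).
  + exact: quad_approx_gradl psiq.
  + exact: quad_approx_gradr psiq.
  + exact: (saddle_is_saddle sigma_gt0 hA sc).
  + by move=> p; exact: (saddle_unique sigma_gt0 hA sc).
- by move=> z Xiz; exact: (saddle_lipschitz sigma_gt0 hA sc).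
- move=> x1 y1 _ _; apply: cvg_within_continuous => z F FF Xiz nXi Fz.
  have x1c : x1 @[_ --> F] --> x1 by exact: cvg_cst.
  have y1c : y1 @[_ --> F] --> y1 by exact: cvg_cst.
  have cx := saddle_x_cvg sigma_gt0 hA hB sc Xiz nXi Fz x1c y1c.
  have cy := saddle_y_cvg sigma_gt0 hA hB sc Xiz nXi Fz x1c y1c.
  have cpx := saddle_px_cvg sigma_gt0 hA hB sc Xiz nXi Fz x1c y1c.
  have cpy := saddle_py_cvg sigma_gt0 hA hB sc Xiz nXi Fz x1c y1c.
  exact: (cvg_pair (cvg_pair (cvg_pair (cx FF) (cy FF)) (cpx FF)) (cpy FF)).
(* Joint continuity of the saddle point on this compact set yields the radii of the hat sets. *)
have K1 : compact (X1 `*` Y1 `*` Xi).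
  by apply: compact_setX; [exact: compact_setX|exact: Xi_compact hB].
have [Mx xM] : exists M, forall p, (X1 `*` Y1 `*` Xi) p ->
    `|saddle_x D p.1.1 p.1.2 p.2| <= M.
  apply: (compact_image_bounded (f := fun p => saddle_x D p.1.1 p.1.2 p.2) K1).
  apply: cvg_within_continuous => -[[x1 y1] z] F FF [_ Xiz] nK /cvg_triple_proj[cx cy cz].
  apply: (saddle_x_cvg sigma_gt0 hA hB sc Xiz _ cz cx cy).
  by apply: filterS nK => p [].
have [My yM] : exists M, forall p, (X1 `*` Y1 `*` Xi) p ->
    `|saddle_y D p.1.1 p.1.2 p.2| <= M.
  apply: (compact_image_bounded (f := fun p => saddle_y D p.1.1 p.1.2 p.2) K1).
  apply: cvg_within_continuous => -[[x1 y1] z] F FF [_ Xiz] nK /cvg_triple_proj[cx cy cz].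
  apply: (saddle_y_cvg sigma_gt0 hA hB sc Xiz _ cz cx cy).
  by apply: filterS nK => p [].
pose ballX M := [set x : 'cV[R]_n2 | `|x| <= M].
pose ballY M := [set y : 'cV[R]_m2 | `|y| <= M].
(* The inner maximizer is now bounded with [x2] ranging over the whole hat ball, not only over
   saddle points: the localized maximum must agree with [f21] on all of it. *)
have [My' yM'] : exists M, forall p, (ballX Mx `*` Y1 `*` Xi) p ->
    `|ysol D p.2 p.1.1 p.1.2| <= M.
  apply: (compact_image_bounded (f := fun p => ysol D p.2 p.1.1 p.1.2)).
    apply: compact_setX; [apply: compact_setX => //|exact: Xi_compact hB].
    exact: closed_ball_compact.
  apply: cvg_within_continuous => -[[x2 y1] z] F FF [_ Xiz] nK /cvg_triple_proj[cx cy cz].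
  apply: (ysol_cvg sigma_gt0 hA hB sc Xiz _ cz cx cy).
  by apply: filterS nK => p [].
have [Mx' xM'] : exists M, forall p, (X1 `*` ballY My `*` Xi) p ->
    `|xsol D p.2 p.1.1 p.1.2| <= M.
  apply: (compact_image_bounded (f := fun p => xsol D p.2 p.1.1 p.1.2)).
    apply: compact_setX; [apply: compact_setX => //|exact: Xi_compact hB].
    exact: closed_ball_compact.
  apply: cvg_within_continuous => -[[x1 y2] z] F FF [_ Xiz] nK /cvg_triple_proj[cx cy cz].
  apply: (xsol_cvg sigma_gt0 hA hB sc Xiz _ cz cx cy).
  by apply: filterS nK => p [].
exists (ballX Mx), (ballY My); split.
- by split; [exact: closed_ball_convex|exact: closed_ball_compact].
- by split; [exact: closed_ball_convex|exact: closed_ball_compact].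
- by move=> x1 y1 z ? ? ?; split; [exact: (xM (x1, y1, z))|exact: (yM (x1, y1, z))].
(* The maxima ensure that the check sets contain both the hat sets and the inner optimizers. *)
exists (ballX (Num.max Mx Mx')), (ballY (Num.max My My')); split.
- by split; [exact: closed_ball_convex|exact: closed_ball_compact].
- by split; [exact: closed_ball_convex|exact: closed_ball_compact].
- by split => x; rewrite /ballX /ballY /= le_max => ->.
- move=> x2 y1 z hx hy Xiz.
  have [_ ub] := is_max_f21 sigma_gt0 hA sc Xiz x2 y1.
  split; last by move=> _ [y2 [Yy _] <-]; apply: ub; exists y2.
  (* The unrestricted maximizer lies in the check ball, so the restriction leaves the maximum
     unchanged. *)
  exists (ysol D z x2 y1); last by rewrite (f21_ysol sigma_gt0 hA sc Xiz).
  split; first exact: (ysol_feasible sigma_gt0 hA sc Xiz).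
  by rewrite /ballY /= le_max (yM' (x2, y1, z)) ?orbT.
- move=> x1 y2 z hx hy Xiz.
  have [_ lb] := is_min_f22 sigma_gt0 hA sc Xiz x1 y2.
  split; last by move=> _ [x2 [Xx _] <-]; apply: lb; exists x2.
  exists (xsol D z x1 y2); last by rewrite (f22_xsol sigma_gt0 hA sc Xiz).
  split; first exact: (xsol_feasible sigma_gt0 hA sc Xiz).
  by rewrite /ballX /= le_max (xM' (x1, y2, z)) ?orbT.
Qed.
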